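(* Let $\mathbb{P}$ be a distribution of $(X,Y)$ on $\mathbb{R}^d\times\{0,1\}$ with $\mathbb{P}(Y=1)\ge p$ for a constant $p>0$, and let $N\ge n$. Suppose that $\mathbb{P}$ satisfies the $\alpha$-margin assumption for some $C_0>0$ and $\alpha\ge0$, and that there exists an estimator $\hat\eta$ of the regression function $\eta$, based on $\mathcal{D}_n$, which satisfies, for all $t>0$, $$\mathbb{P}^{\otimes n}\big(|\hat\eta(x)-\eta(x)|\ge t\big)\le C_1\exp(-C_2a_nt^2)\qquad\text{for }\mathbb{P}_X\text{-almost every }x ,$$ for some universal constants $C_1,C_2>0$ and an increasing sequence $a_n:\mathbb{N}\to\mathbb{R}_+$. Then there exists a constant $C>0$, which depends on $\alpha,C_0,C_1,C_2,p$, such that $$\mathbb{E}_{(\mathcal{D}_n,\mathcal{D}_N)}\,\mathcal{E}_1(\hat g)\le C\left(a_n^{-\frac{1+\alpha}{2}}+N^{-\frac{1+\alpha}{2}}\right),$$ where $\hat g(x)=\mathbf{1}\{\hat\eta(x)>\hat\theta\}$ and $\hat\theta$ is the unique solution in $\theta$ of $$\theta\,\frac1N\sum_{X_i\in\mathcal{D}_N}\hat\eta(X_i)=\frac1N\sum_{X_i\in\mathcal{D}_N}(\hat\eta(X_i)-\theta)_+ .$$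
   Context: $(X,Y)\sim\mathbb{P}$, $\mathbb{P}_X$ is the marginal law of $X$, and $\eta(x)=\mathbb{P}(Y=1\mid X=x)$ is the regression function. The labeled sample $\mathcal{D}_n=\{(X_i,Y_i)\}_{i=1}^n$ consists of i.i.d. copies of $(X,Y)$ and has law $\mathbb{P}^{\otimes n}$. The unlabeled sample $\mathcal{D}_N=\{X_i\}_{i=n+1}^{n+N}$ consists of independent copies of $X\sim\mathbb{P}_X$ and is independent of $\mathcal{D}_n$. $\mathbb{E}_{(\mathcal{D}_n,\mathcal{D}_N)}$ is expectation under $\mathbb{P}^{\otimes n}\otimes\mathbb{P}_X^{\otimes N}$. The constants $C_0,C_1,C_2,p$ do not depend on $n,N$. Here $(u)_+=\max(u,0)$. For a classifier (measurable function) $g:\mathbb{R}^d\to\{0,1\}$, the (normalized) $\mathrm{F}_1$-score is $$F_1(g)=\frac{\mathbb{P}(Y=1,g(X)=1)}{\mathbb{P}(Y=1)+\mathbb{P}(g(X)=1)}.$$ The excess score is $\mathcal{E}_1(g)=F_1(g^* )-F_1(g)$, where $g^*$ is a maximizer of $F_1$ over all classifiers. The optimal threshold $\theta^*\in[0,1]$ is the unique root of $\theta\,\mathbb{P}(Y=1)=\mathbb{E}(\eta(X)-\theta)_+$. The $\alpha$-margin assumption (with constants $C_0>0$ and $\delta_0\in(0,1/12]$) is: for every positive $\delta\le\delta_0$, $$\mathbb{P}_X\big(0<|\eta(X)-\theta^*|\le\delta\big)\le C_0\delta^\alpha .$$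
   Formalization: The constant C may also depend on the margin constant δ_0, which the statement's list omits; with C uniform in δ_0 the claim fails for α>0, since the margin assumption becomes empty as δ_0 tends to 0. *)

(* Defs.v *)
From HB Require Import structures.
From mathcomp Require Import all_boot all_order all_algebra.
From mathcomp Require Import all_classical all_reals all_analysis.

Set Implicit Arguments.
Unset Strict Implicit.
Unset Printing Implicit Defensive.

Import Order.TTheory GRing.Theory Num.Theory.
Import numFieldNormedType.Exports.

Local Open Scope classical_set_scope.
Local Open Scope ring_scope.

Definition tuple_cons (dT : measure_display) (T : measurableType dT) (n : nat)
    (z : T * n.-tuple T) : n.+1.-tuple T :=
  [tuple of z.1 :: z.2].

Lemma measurable_tuple_cons (dT : measure_display) (T : measurableType dT)
    (n : nat) : measurable_fun setT (@tuple_cons dT T n).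
Proof. exact: (measurable_cons measurable_fst measurable_snd). Qed.

HB.instance Definition _ (d1 d2 : measure_display) (T1 : measurableType d1)
    (T2 : measurableType d2) :=
  isMeasurableFun.Build _ _ _ _ (@fst T1 T2) measurable_fst.

HB.instance Definition _ (dT : measure_display) (T : measurableType dT)
    (n : nat) :=
  isMeasurableFun.Build _ _ _ _ (@tuple_cons dT T n)
    (@measurable_tuple_cons dT T n).

(* The n-fold product measure, on n-tuples with the sigma-algebra generated by
   the coordinates; [iid_lawE] gives its values on rectangles. *)
Fixpoint iid_law (dT : measure_display) (T : measurableType dT) (R : realType)
    (P : probability T R) (n : nat) : probability (n.-tuple T) R :=
  match n with
  | 0 => dirac [tuple]
  | n'.+1 => distribution (P \x iid_law P n')%E (@tuple_cons dT T n')
  end.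

Lemma iid_lawE (dT : measure_display) (T : measurableType dT) (R : realType)
    (P : probability T R) (n : nat) (A : 'I_n -> set T) :
  (forall i, measurable (A i)) ->
  iid_law P n [set s | forall i, A i (tnth s i)] = (\prod_(i < n) P (A i))%E.
Proof.
elim: n A => [|n IH] A mA.
  by rewrite big_ord0 /= diracE mem_set//= => -[].
rewrite big_ord_recl -IH; last by move=> i; exact: mA.
rewrite /= /distribution /pushforward /=.
rewrite [X in (_ \x _)%E X](_ : _ =
  A ord0 `*` [set s : n.-tuple T | forall i, A (lift ord0 i) (tnth s i)]).
  rewrite product_measure1E//.
  rewrite [X in measurable X](_ : _ = \bigcap_(i in [set: 'I_n])
    ((fun s : n.-tuple T => tnth s i) @^-1` A (lift ord0 i))).
    apply: fin_bigcap_measurable => // i _; rewrite -[X in measurable X]setTI.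
    exact: (measurable_tnth i).
  by apply/seteqP; split=> s /= h i; [move=> _|]; exact: h.
apply/seteqP; split => -[x s] /=.
  move=> h; split; first exact: (h ord0).
  by move=> i; have := h (lift ord0 i); rewrite tnthS.
move=> [hx hs] i; case: (unliftP ord0 i) => [j|] ->; last exact: hx.
by rewrite tnthS.
Qed.

Section binary_classification.
Context {R : realType} {d : nat}.
Implicit Types (P : probability (d.-tuple R * bool)%type R)
  (eta f : d.-tuple R -> R) (g : d.-tuple R -> bool) (theta : R).

Definition lawX P : probability (d.-tuple R) R :=
  distribution P (@fst (d.-tuple R) bool).

Definition label1 : set (d.-tuple R * bool) :=
  [set z : d.-tuple R * bool | z.2].

(* [eta] is a version of x |-> P (Y = 1 | X = x). *)
Definition regression_function P eta : Prop :=
  [/\ measurable_fun setT eta,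
      forall x, 0 <= eta x <= 1 &
      forall A : set (d.-tuple R), measurable A ->
        P [set z | A z.1 /\ label1 z] = (\int[lawX P]_(x in A) (eta x)%:E)%E].

(* The normalized F_1-score P(Y = 1, g(X) = 1) / (P(Y = 1) + P(g(X) = 1)),
   without the customary factor 2. *)
Definition F1 P g : R :=
  fine (P [set z | label1 z /\ g z.1]) /
  (fine (P label1) + fine (P [set z | g z.1])).

Definition F1_optimal P (gstar : d.-tuple R -> bool) : Prop :=
  measurable_fun setT gstar /\
  forall g, measurable_fun setT g -> F1 P g <= F1 P gstar.

Definition excess_F1 P (gstar g : d.-tuple R -> bool) : R :=
  F1 P gstar - F1 P g.

Definition optimal_threshold P eta theta : Prop :=
  0 <= theta <= 1 /\
  (theta%:E * P label1 = \int[lawX P]_x (Num.max (eta x - theta) 0)%R%:E)%E.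

Definition margin_assumption P eta (thetastar alpha C0 delta0 : R) : Prop :=
  forall delta : R, 0 < delta <= delta0 ->
    (lawX P [set x | (0 < `|eta x - thetastar| <= delta)%R]
       <= (C0 * delta `^ alpha)%:E)%E.

Definition empirical_threshold_eq f (N : nat) (DN : N.-tuple (d.-tuple R))
    theta : Prop :=
  theta * (N%:R^-1 * \sum_(i < N) f (tnth DN i)) =
  N%:R^-1 * \sum_(i < N) Num.max (f (tnth DN i) - theta) 0.

(* The equation has exactly one solution as soon as the empirical mean of [f]
   is positive, but may have none or several otherwise (for instance when [f]
   vanishes on the sample). A measurable rule [thetahat] is only required to
   return the solution when there is exactly one: its values on the other
   samples are arbitrary. *)
Definition plugin_threshold (n N : nat)
    (etahat : n.-tuple (d.-tuple R * bool) -> d.-tuple R -> R)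
    (thetahat : n.-tuple (d.-tuple R * bool) * N.-tuple (d.-tuple R) -> R)
    : Prop :=
  measurable_fun setT thetahat /\
  forall Dn DN theta,
    unique (empirical_threshold_eq (etahat Dn) DN) theta ->
    thetahat (Dn, DN) = theta.

Definition plugin_classifier f theta : d.-tuple R -> bool :=
  fun x => theta < f x.

End binary_classification.

(* Main.v *)
(** Write u = |eta - theta*|, b = min(a_n, N), and let D = (D_n, D_N).
    Since theta* = F1(1{eta > theta*}) bounds F1 and
      theta* - F1(g) = E[u 1{g <> 1{eta > theta*}}] / (P(Y=1) + P(g=1)),
    the excess score of the plug-in rule is at most
      p^-1 E_X[u 1{0 < u <= Z}],  Z = |etahat - eta| + |thetahat - theta*|.
    The empirical equation is strongly monotone in theta, with slope the
    empirical mean of etahat; evaluating it at the deterministic point theta*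
    gives |thetahat - theta*| <= (2/p) (2 S + T), where S is the empirical mean
    of |etahat - eta| and T is a centred empirical mean at theta*, as soon as
    the mean of etahat is at least p/2; Hoeffding's inequality controls the
    complement. All deviations are measured by polynomial tails
      P(. >= t) <= K / (b t^2)^m  with 2 + alpha <= m:
    such tails pass from |etahat(x) - eta(x)| to the average S, although its
    terms are dependent, and they suffice to sum E_X[u 1{0 < u <= Z}] over the
    dyadic shells 2^k / sqrt b < u <= 2^(k+1) / sqrt b using the margin
    assumption. *)

Require Import Defs.
From HB Require Import structures.
From mathcomp Require Import all_boot all_order all_algebra.
From mathcomp Require Import all_classical all_reals all_analysis.
From mathcomp Require Import measurable_realfun ring lra.

Set Implicit Arguments.
Unset Strict Implicit.
Unset Printing Implicit Defensive.

Import Order.TTheory GRing.Theory Num.Theory.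
Import numFieldNormedType.Exports.

Local Open Scope classical_set_scope.
Local Open Scope ring_scope.

(** * Exponential inequalities and helpers on measures *)

(** Raise [expR (y / m) >= y / m] to the power m. This turns exponential tails into the polynomial
    ones in which all deviations are measured. *)
Lemma expRN_le_poly (R : realType) (m : nat) (y : R) :
  (0 < m)%N -> 0 < y -> expR (- y) <= m%:R ^+ m / y ^+ m.
Proof.
move=> m0 y0; have mR : (0 : R) < m%:R by rewrite ltr0n.
rewrite expRN -[leRHS]invrK lef_pV2 ?posrE ?expR_gt0 ?invr_gt0 ?divr_gt0 ?exprn_gt0//.
rewrite invf_div -expr_div_n.
have {2}-> : y = m%:R * (y / m%:R) by rewrite mulrC divfK// gt_eqF.
rewrite expRM_natl lerXn2r ?nnegrE ?expR_ge0 ?divr_ge0 ?(ltW y0) ?(ltW mR)//.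
by apply: le_trans (expR_ge1Dx _); rewrite lerDr.
Qed.

(** Write [expR x] as the inverse square of [expR (- (x / 2)) >= 1 - x / 2]. It remains that (1 -
    x/2)^2 (1 + x + x^2) - 1 = x^2 (1 - 3x + x^2) / 4 is nonnegative, which holds for x <= 1/3. *)
Lemma expR_le_quadratic (R : realType) (x : R) :
  `|x| <= 3^-1 -> expR x <= 1 + x + x ^+ 2.
Proof.
rewrite ler_norml => /andP[x1 x2].
have h : 1 - x / 2 <= expR (- (x / 2)) by have := expR_ge1Dx (- (x / 2)).
have p0 : 0 < 1 - x / 2 by lra.
have E : expR x = (expR (- (x / 2))) ^- 2.
  by rewrite -expRM_natl -expRN; congr expR; field.
rewrite E -[leRHS]invrK lef_pV2 ?posrE ?exprn_gt0 ?expR_gt0 ?invr_gt0//; last by nra.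
have q0 : 0 < 1 + x + x ^+ 2 by nra.
apply: (@le_trans _ _ ((1 - x / 2) ^+ 2)); last first.
  by rewrite lerXn2r ?nnegrE ?expR_ge0 ?(ltW p0).
rewrite -[leLHS]mul1r ler_pdivrMr// -subr_ge0.
have -> : (1 - x / 2) ^+ 2 * (1 + x + x ^+ 2) - 1 =
   x ^+ 2 * ((1 - 3 * x + x ^+ 2) / 4) by field.
by apply: mulr_ge0; [exact: sqr_ge0|nra].
Qed.

Lemma nneseries_le (R : realType) (u : (\bar R)^nat) (c : \bar R) :
  (forall k, 0 <= u k)%E -> (forall n, \sum_(k < n) u k <= c)%E ->
  (\sum_(k <oo) u k <= c)%E.
Proof.
move=> u0 uc; apply: lime_le; first by apply: is_cvg_nneseries.
by apply: nearW => n; rewrite big_mkord.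
Qed.

Lemma measurable_bool_set (d : measure_display) (T : measurableType d)
    (f : T -> bool) : measurable_fun setT f -> measurable [set x | f x].
Proof.
move=> mf; rewrite (_ : [set x | f x] = f @^-1` [set true])//.
by rewrite -[X in measurable X]setTI; exact: mf.
Qed.

Lemma indic_boolE (T : Type) (R : pzRingType) (f : T -> bool) :
  \1_[set x | f x] = (fun x => (f x)%:R) :> (T -> R).
Proof.
apply/funext => x; rewrite indicE; congr ((_ : bool)%:R).
by apply/idP/idP => [/set_mem|fx]//; exact: mem_set.
Qed.

(** Markov's inequality, with f any nonnegative majorant of the indicator of A. *)
Lemma le_integral_indic (d : measure_display) (T : measurableType d)
    (R : realType) (mu : measure T R) (A : set T) (f : T -> \bar R) :
  measurable A -> measurable_fun setT f -> (forall x, 0 <= f x)%E ->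
  (forall x, A x -> 1 <= f x)%E -> (mu A <= \int[mu]_x f x)%E.
Proof.
move=> mA mf f0 f1; rewrite -[A]setIT -integral_indic//.
apply: ge0_le_integral => //. 
- by apply/measurable_EFinP; exact: measurable_indic.
- move=> x _; rewrite indicE.
  by have [/set_mem/f1//|_] := boolP (x \in A); exact: f0.
Qed.

(** * Polynomial tails of averages of possibly dependent variables *)

(* Bounds the excess of y / tau over 1 by indicators of the events
   2^k tau <= y, so that tail bounds can be integrated termwise. *)
Definition dyadic_majorant (R : realType) (tau y : R) : \bar R :=
  (\sum_(k <oo) (2 ^+ k.+1 * (2 ^+ k * tau <= y)%R%:R)%:E)%E.

(** Let k be the last index with [2 ^+ k * tau <= y]: its term alone is 2^(k+1), which exceeds y /
    tau. If there is no such index, then y < tau and the left side is negative. *)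
Lemma dyadic_majorant_ge (R : realType) (tau y : R) :
  0 < tau -> 0 <= y -> ((y / tau - 1)%:E <= dyadic_majorant tau y)%E.
Proof.
move=> tau0 y0.
have t0 (k : nat) : (0 <= (2 ^+ k.+1 * (2 ^+ k * tau <= y)%R%:R)%:E :> \bar R)%E.
  by rewrite lee_fin mulr_ge0// exprn_ge0.
have [yt|yt] := ltP y tau.
  apply: (@le_trans _ _ 0%E); last exact: nneseries_ge0.
  by rewrite lee_fin subr_le0 ler_pdivrMr// mul1r ltW.
have bnd : exists k, y < 2 ^+ k * tau.
  exists (Num.bound (y / tau)).
  by rewrite -ltr_pdivrMr//; exact: upper_nthrootP.
case: (ex_minnP bnd) => [[|k]].
  by rewrite mul1r ltNge yt.
move=> yk kmin.
have ky : 2 ^+ k * tau <= y.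
  by rewrite leNgt; apply/negP => /kmin; rewrite ltnn.
apply: (@le_trans _ _ (\sum_(0 <= i < k.+1)
    (2 ^+ i.+1 * (2 ^+ i * tau <= y)%R%:R)%:E)%E); last by apply: nneseries_lim_ge => *; exact: t0.
rewrite big_nat_recr//=; apply: (@le_trans _ _ ((2 ^+ k.+1)%:E : \bar R)).
  rewrite lee_fin lerBlDr ler_pdivrMr// mulrDl.
  apply: le_trans (ltW yk) _; rewrite lerDl mul1r; exact: ltW.
rewrite ky mulr1; apply: leeDr.
by apply: sume_ge0 => i _; exact: t0.
Qed.

(** Markov's inequality and linearity of the integral suffice, so the [f i] may be dependent. Each
    [f i / tau - 1] lies below a dyadic majorant, whose integral is bounded by a geometric series:
    the weight 2^(k+1) meets a tail of order 4^(-k m), and m >= 1 leaves a ratio of at most 1/2. *)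
Lemma tail_average (d : measure_display) (T : measurableType d)
    (R : realType) (mu : probability T R) (N m : nat) (f : 'I_N -> T -> R) (K b : R) :
  (0 < N)%N -> (0 < m)%N -> 0 < K -> 0 < b ->
  (forall i, measurable_fun setT (f i)) ->
  (forall i x, 0 <= f i x) ->
  (forall t, 0 < t -> forall i,
     (mu [set x | t <= f i x]%R <= (K / (b * t ^+ 2) ^+ m)%:E)%E) ->
  forall t, 0 < t ->
    (mu [set x | t <= N%:R^-1 * \sum_(i < N) f i x]%R <=
     (4 * 4 ^+ m * K / (b * t ^+ 2) ^+ m)%:E)%E.
Proof.
move=> N0 m0 K0 b0 mf f0 tailf t t0.
have NR : (0 : R) < N%:R by rewrite ltr0n.
(* Halving t makes the average of [f i / tau - 1] at least 1 on the event, as Markov's inequality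
   requires; it costs the factor 4^m in the constant. *)
pose tau := t / 2; have tau0 : 0 < tau by rewrite divr_gt0.
pose e i k x : \bar R := (2 ^+ k.+1 * (2 ^+ k * tau <= f i x)%R%:R)%:E.
have me i k : measurable_fun setT (e i k).
  apply/measurable_EFinP; apply: measurable_funM => //.
  rewrite -indic_boolE; apply: measurable_indic.
  by apply: measurable_bool_set; exact: measurable_fun_ler.
have e0 i k x : (0 <= e i k x)%E by rewrite lee_fin mulr_ge0// exprn_ge0.
have mdy i : measurable_fun setT (fun x => dyadic_majorant tau (f i x)).
  by apply: ge0_emeasurable_sum => [k x _ _|k _]; [exact: e0|exact: me].
have dy0 i x : (0 <= dyadic_majorant tau (f i x))%E by exact: nneseries_ge0.
have int_e i k : (\int[mu]_x e i k x <= (2 * K / (b * tau ^+ 2) ^+ m * 2^-1 ^+ k)%:E)%E.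
  rewrite (_ : \int[mu]_x e i k x =
     (2 ^+ k.+1)%:E * mu [set x | 2 ^+ k * tau <= f i x]%R)%E; last first.
    under eq_integral do rewrite /e EFinM.
    rewrite ge0_integralZl//=; last first.
      apply/measurable_EFinP.
      rewrite -indic_boolE; apply: measurable_indic.
      by apply: measurable_bool_set; exact: measurable_fun_ler.
    congr (_ * _)%E; rewrite -[X in mu X]setIT -integral_indic//.
      by rewrite indic_boolE.
    by apply: measurable_bool_set; exact: measurable_fun_ler.
  apply: (@le_trans _ _ ((2 ^+ k.+1)%:E * (K / (b * (2 ^+ k * tau) ^+ 2) ^+ m)%:E)%E).
    apply: lee_wpmul2l; first by rewrite lee_fin exprn_ge0.
    by apply: tailf; rewrite mulr_gt0// exprn_gt0.
  rewrite -EFinM lee_fin.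
  have -> : (b * (2 ^+ k * tau) ^+ 2) ^+ m = ((2 ^+ k) ^+ 2) ^+ m * (b * tau ^+ 2) ^+ m.
    by rewrite !exprMn; ring.
  have B0 : 0 < (b * tau ^+ 2) ^+ m by rewrite exprn_gt0// mulr_gt0// exprn_gt0.
  have P0 : 0 < (2 : R) ^+ k by rewrite exprn_gt0.
  have key : 2 ^+ k / ((2 ^+ k) ^+ 2) ^+ m <= (2 ^+ k)^-1 :> R.
    rewrite ler_pdivrMr ?exprn_gt0// mulrC ler_pdivlMr// -expr2.
    by rewrite -[leLHS]expr1 ler_weXn2l// !exprn_ege1// ler1n.
  have -> : 2 ^+ k.+1 * (K / (((2 ^+ k) ^+ 2) ^+ m * (b * tau ^+ 2) ^+ m)) =
      2 * K / (b * tau ^+ 2) ^+ m * (2 ^+ k / ((2 ^+ k) ^+ 2) ^+ m).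
    by rewrite exprS invfM; ring.
  rewrite exprVn ler_wpM2l// divr_ge0// ?(ltW B0)// mulr_ge0// ltW//.
have int_dy i : (\int[mu]_x dyadic_majorant tau (f i x) <=
    (4 * K / (b * tau ^+ 2) ^+ m)%:E)%E.
  rewrite /dyadic_majorant (integral_nneseries mu measurableT (me i))//.
  apply: nneseries_le => [k|k].
    by apply: integral_ge0 => x _; exact: e0.
  apply: (@le_trans _ _ (\sum_(i < k) (2 * K / (b * tau ^+ 2) ^+ m * 2^-1 ^+ i)%:E)%E).
    by apply: lee_sum => j _; exact: int_e.
  rewrite sumEFin lee_fin -mulr_sumr.
  have -> : 4 * K / (b * tau ^+ 2) ^+ m = 2 * K / (b * tau ^+ 2) ^+ m * 2 by ring.
  rewrite ler_wpM2l//.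
    by rewrite divr_ge0 ?exprn_ge0// ?mulr_ge0 ?exprn_ge0// ltW.
  (* The partial geometric sum satisfies S / 2 = 1 - 2^-k, so S <= 2. *)
  have /(congr1 -%R) := subrX1 (2^-1 : R) k.
  set S := \sum_(i < k) _ => hS.
  have : 0 <= (2^-1 : R) ^+ k by rewrite exprn_ge0// invr_ge0.
  by move: hS; lra.
have -> : (b * t ^+ 2) ^+ m = 4 ^+ m * (b * tau ^+ 2) ^+ m.
  by rewrite -exprMn; congr (_ ^+ _); rewrite /tau; field.
rewrite [X in (_ <= X%:E)%E](_ : _ = 4 * K / (b * tau ^+ 2) ^+ m); last first.
  rewrite invfM mulrA; congr (_ / _).
  by field; rewrite expf_neq0.
pose F x : \bar R := ((N%:R^-1)%:E * \sum_(i < N) dyadic_majorant tau (f i x))%E.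
have mF : measurable_fun setT F.
  by apply: measurable_funeM; apply: emeasurable_sum.
have s0 x : (0 <= \sum_(i < N) dyadic_majorant tau (f i x))%E by apply: sume_ge0.
apply: (@le_trans _ _ (\int[mu]_x F x)%E).
  apply: le_integral_indic => //.
  - apply: measurable_bool_set; apply: measurable_fun_ler => //.
    by apply: measurable_funM => //; exact: measurable_sum.
  - by move=> x; rewrite mule_ge0// lee_fin invr_ge0 ltW.
  move=> x /= tx.
  apply: (@le_trans _ _ ((N%:R^-1)%:E * \sum_(i < N) (f i x / tau - 1)%:E)%E).
    rewrite sumEFin -EFinM lee_fin big_split/= sumr_const card_ord -mulr_suml.
    rewrite mulrDr mulNrn mulrN mulVf ?gt_eqF// mulrA lerBrDr ler_pdivlMr//.
    by apply: le_trans tx; rewrite /tau; lra.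
  apply: lee_wpmul2l; first by rewrite lee_fin invr_ge0 ltW.
  by apply: lee_sum => i _; exact: dyadic_majorant_ge.
rewrite ge0_integralZl//; last exact: emeasurable_sum.
rewrite ge0_integral_sum//.
rewrite lee_pdivrMl//.
apply: (@le_trans _ _ (\sum_(i < N) (4 * K / (b * tau ^+ 2) ^+ m)%:E)%E).
  by apply: lee_sum.
by rewrite sumEFin -EFinM lee_fin sumr_const card_ord -[leLHS]mulr_natl.
Qed.

(** * Hoeffding's inequality for iid samples *)

Section iid_exponential.
Context (d : measure_display) (T : measurableType d) (R : realType)
  (Q : probability T R) (V : T -> R).
Hypotheses (mV : measurable_fun setT V) (V1 : forall x, `|V x| <= 1)
  (V0 : (\int[Q]_x (V x)%:E <= 0)%E).

Lemma bounded_integrable : Q.-integrable setT (EFin \o V).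
Proof.
apply: measurable_bounded_integrable => //.
  by apply: le_lt_trans (probability_le1 _ _) _ => //; rewrite ltry.
exists 1; split => // M M1 x _; exact: le_trans (V1 x) (ltW M1).
Qed.

(** In the quadratic bound on the exponential, the linear term has nonpositive mean since l >= 0,
    and V^2 <= 1. This leaves 1 + l^2 <= exp(l^2). The range of l keeps l V within [-1/3, 1/3]. *)
Lemma integral_expR_centered (l : R) : 0 <= l <= 3^-1 ->
  (\int[Q]_x (expR (l * V x))%:E <= (expR (l ^+ 2))%:E)%E.
Proof.
move=> /andP[l0 l1].
have lV x : `|l * V x| <= 3^-1.
  by rewrite normrM ger0_norm//; have := V1 x; have := normr_ge0 (V x); nra.
have Vl x : - 3^-1 <= l * V x <= 3^-1 by rewrite -ler_norml.
have mlV : measurable_fun setT (fun x => l * V x) by exact: measurable_funM.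
apply: (@le_trans _ _ (\int[Q]_x (1 + l ^+ 2 + l * V x)%:E)%E).
  apply: ge0_le_integral => //.
  - by apply/measurable_EFinP; exact: measurableT_comp.
  - by apply/measurable_EFinP; exact: measurable_funD.
  move=> x _; rewrite lee_fin; apply: le_trans (expR_le_quadratic (lV x)) _.
  have : (l * V x) ^+ 2 <= l ^+ 2.
    rewrite exprMn ler_piMr ?sqr_ge0//.
    by have := V1 x; rewrite ler_norml => /andP[]; nra.
  lra.
have iV := bounded_integrable.
have ilV : Q.-integrable setT (fun x => l%:E * (V x)%:E)%E by exact: integrableZl.
have i1 : Q.-integrable setT (fun x => (1 + l ^+ 2)%:E : \bar R).
  by apply: finite_measure_integrable_cst.
under eq_integral do rewrite EFinD EFinM.
rewrite integralD// integralZl// integral_cst// [X in (_ * X)%E]probability_setT mule1.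
apply: (@le_trans _ _ (1 + l ^+ 2)%:E); last first.
  by rewrite lee_fin; exact: expR_ge1Dx.
by apply: geeDl; apply: mule_ge0_le0.
Qed.

(** Induction on N: [iid_law] peels off the first coordinate, the exponential of the sum factors,
    and Tonelli's theorem separates the two integrals. *)
Lemma iid_law_expR_le (l : R) (N : nat) : 0 <= l <= 3^-1 ->
  (\int[iid_law Q N]_s (expR (l * \sum_(i < N) V (tnth s i)))%:E
     <= (expR (N%:R * l ^+ 2))%:E)%E.
Proof.
move=> hl.
have mS k : measurable_fun setT (fun s : k.-tuple T => \sum_(i < k) V (tnth s i)).
  by apply: measurable_sum => i; apply: measurableT_comp => //; exact: measurable_tnth.
have me k : measurable_fun setT
    (fun s : k.-tuple T => (expR (l * \sum_(i < k) V (tnth s i)))%:E).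
  apply/measurable_EFinP; apply: measurableT_comp => //.
  by apply: measurable_funM => //; exact: mS.
elim: N => [|N IH].
  rewrite /= integral_dirac//; last exact: me.
  by rewrite diracE mem_set// big_ord0 mulr0 mul0r mul1e.
rewrite /iid_law -/(iid_law Q N) ge0_integral_pushforward//; last exact: me.
rewrite preimage_setT.
under eq_integral => z _.
  rewrite /= big_ord_recl mulrDr expRD tnth0.
  under eq_bigr do rewrite tnthS.
  rewrite EFinM; over.
rewrite fubini_tonelli1//=; last first.
  apply: emeasurable_funM.
    apply/measurable_EFinP; apply: measurableT_comp => //.
    by apply: measurable_funM => //; apply: measurableT_comp.
  by apply: measurableT_comp (me N) _.
rewrite /fubini_F/=.
under eq_integral => x _.
  rewrite ge0_integralZl//=; last exact: me.
  over.
apply: (@le_trans _ _ (\int[Q]_x ((expR (l * V x))%:E * (expR (N%:R * l ^+ 2))%:E))%E).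
  apply: ge0_le_integral => //=.
  - move=> x _; apply: mule_ge0; first by rewrite lee_fin expR_ge0.
    by apply: integral_ge0 => s _; rewrite lee_fin expR_ge0.
  - apply: emeasurable_funM => //; apply/measurable_EFinP.
    by apply: measurableT_comp => //; exact: measurable_funM.
  - apply: emeasurable_funM => //; apply/measurable_EFinP.
    by apply: measurableT_comp => //; exact: measurable_funM.
  by move=> x _; apply: lee_wpmul2l => //; rewrite lee_fin expR_ge0.
rewrite ge0_integralZr//=; last first.
  by apply/measurable_EFinP; apply: measurableT_comp => //; exact: measurable_funM.
apply: (@le_trans _ _ ((expR (l ^+ 2))%:E * (expR (N%:R * l ^+ 2))%:E)%E).
  by apply: lee_wpmul2r; [rewrite lee_fin expR_ge0|exact: integral_expR_centered].
by rewrite -EFinM lee_fin -expRD -[X in X + _]mul1r -mulrDl -natr1 addrC.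
Qed.

(** Chernoff's method: Markov's inequality applied to exp(l (sum - N t)). *)
Lemma hoeffding (N : nat) (t : R) : (0 < N)%N -> 0 < t ->
  (iid_law Q N [set s | t <= N%:R^-1 * \sum_(i < N) V (tnth s i)]%R
     <= (expR (- (N%:R * (t ^+ 2 / 9))))%:E)%E.
Proof.
move=> N0 t0; have NR : (0 : R) < N%:R by rewrite ltr0n.
have mS : measurable_fun setT (fun s : N.-tuple T => \sum_(i < N) V (tnth s i)).
  by apply: measurable_sum => i; apply: measurableT_comp => //; exact: measurable_tnth.
have mA : measurable [set s : N.-tuple T | t <= N%:R^-1 * \sum_(i < N) V (tnth s i)]%R.
  apply: measurable_bool_set; apply: measurable_fun_ler => //.
  exact: measurable_funM.
(* For t > 1 the event is empty, because an average of values of V is at most 1. *)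
have [t1|t1] := ltP 1 t.
  rewrite (_ : [set _ | _] = set0) ?measure0 ?lee_fin ?expR_ge0//.
  apply/seteqP; split => // s /=; rewrite leNgt => /negP; apply.
  apply: le_lt_trans t1; rewrite ler_pdivrMl// mulr1.
  apply: (@le_trans _ _ (\sum_(i < N) 1)); last by rewrite sumr_const card_ord.
  apply: ler_sum => i _; exact: le_trans (ler_norm _) (V1 _).
(* Admissible since t <= 1 gives l <= 1/3. The exponent becomes -N t^2/3 + N t^2/9 = -2 N t^2/9, and
   half of it is given away. *)
pose l := t / 3.
have hl : 0 <= l <= 3^-1 by rewrite /l; lra.
pose c := expR (- (l * (N%:R * t))).
pose f (s : N.-tuple T) := (c%:E * (expR (l * \sum_(i < N) V (tnth s i)))%:E)%E.
have me : measurable_fun setT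
    (fun s : N.-tuple T => (expR (l * \sum_(i < N) V (tnth s i)))%:E).
  apply/measurable_EFinP; apply: measurableT_comp => //.
  by apply: measurable_funM => //; exact: mS.
apply: (@le_trans _ _ (\int[iid_law Q N]_s f s)%E).
  apply: le_integral_indic => //.
  - exact: measurable_funeM.
  - by move=> s; rewrite /f -EFinM lee_fin mulr_ge0// expR_ge0.
  move=> s /=; rewrite ler_pdivlMl// => h.
  rewrite /f -EFinM lee_fin -expRD -[leLHS]expR0 ler_expR addrC subr_ge0.
  by apply: ler_wpM2l => //; case/andP: hl.
rewrite ge0_integralZl//; last by rewrite lee_fin expR_ge0.
apply: (@le_trans _ _ (c%:E * (expR (N%:R * l ^+ 2))%:E)%E).
  by apply: lee_wpmul2l; [rewrite lee_fin expR_ge0|exact: iid_law_expR_le].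
rewrite -EFinM lee_fin -expRD ler_expR /l.
have -> : - (t / 3 * (N%:R * t)) + N%:R * (t / 3) ^+ 2 =
  - (N%:R * (t ^+ 2 * (2 / 9))) by field.
by rewrite lerN2 ler_pM2l// ler_wpM2l ?sqr_ge0//; lra.
Qed.

End iid_exponential.

(** * Dyadic peeling under a margin condition *)

Lemma product_measure_ysection (d1 d2 : measure_display) (T1 : measurableType d1)
    (T2 : measurableType d2) (R : realType) (m1 : probability T1 R)
    (m2 : probability T2 R) (E : set (T1 * T2)) : measurable E ->
  ((m1 \x m2) E = \int[m2]_x m1 (ysection E x))%E.
Proof.
move=> mE; transitivity (\int[m1]_x fubini_F m2 (EFin \o \1_E) x)%E.
  by rewrite -indic_fubini_tonelli1// integral_indic// setIT.
by rewrite indic_fubini_tonelli// indic_fubini_tonelli_GE.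
Qed.

(** Multiplies a tail bound in the sample, valid for almost every x, by the mass of a shell A of
    points x: the section of E at x is empty off A and has measure at most c for almost every x in
    A. *)
Lemma product_measure_le (d1 d2 : measure_display) (T1 : measurableType d1)
    (T2 : measurableType d2) (R : realType) (m1 : probability T1 R)
    (m2 : probability T2 R) (E : set (T1 * T2)) (A : set T2) (c : R) :
  measurable E -> measurable A -> (E `<=` [set z | A z.2]) -> 0 <= c ->
  {ae m2, forall x, m1 (ysection E x) <= c%:E}%E ->
  ((m1 \x m2) E <= c%:E * m2 A)%E.
Proof.
move=> mE mA EA c0 h; rewrite product_measure_ysection//.
rewrite -[X in m2 X]setIT -integral_indic// -ge0_integralZl//; last first.
  by apply/measurable_EFinP; exact: measurable_indic.
apply: ae_ge0_le_integral => //.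
- exact: measurable_fun_ysection.
- by move=> x _; rewrite -EFinM lee_fin mulr_ge0.
- by apply: measurable_funeM; apply/measurable_EFinP; exact: measurable_indic.
apply: filterS h => x hx _; rewrite indicE.
have [xA|xA] := boolP (x \in A); first by rewrite mule1.
rewrite mule0 (_ : ysection E x = set0) ?measure0//.
apply/seteqP; split => // y; rewrite /ysection/= inE => /EA/= Ax.
by move: xA; rewrite mem_set.
Qed.

(** If u > r, then u lies in a shell between 2^k r and 2^(k+1) r, and u <= z forces
    [2 ^+ k * r <= z]. The induction adds the outermost shell. *)
Lemma dyadic_peeling (R : realType) (r u z : R) (n : nat) : 0 < r ->
  0 <= u <= 2 ^+ n * r ->
  u * (0 < u <= z)%R%:R <= r * (0 < u <= r)%R%:R +
    \sum_(k < n) 2 ^+ k.+1 * r *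
      ((0 < u <= 2 ^+ k.+1 * r) && (2 ^+ k * r <= z))%R%:R.
Proof.
move=> r0; elim: n => [|n IH] /andP[u0 un].
  rewrite big_ord0 addr0; rewrite mul1r in un; rewrite un andbT.
  case: ltP => [u1|u1]/=; last by rewrite !mulr0.
  rewrite mulr1; apply: le_trans un; rewrite -[leRHS]mulr1.
  by rewrite ler_pM2l// lern1; case: (_ <= _).
have c0 k : 0 <= 2 ^+ k * r by rewrite mulr_ge0 ?exprn_ge0// ltW.
rewrite big_ord_recr/= addrA.
have t0 : 0 <= r * (0 < u <= r)%R%:R + \sum_(k < n) 2 ^+ k.+1 * r *
      ((0 < u <= 2 ^+ k.+1 * r) && (2 ^+ k * r <= z))%R%:R.
  rewrite addr_ge0 ?(mulr_ge0 (ltW r0))//.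
  by apply: sumr_ge0 => k _; rewrite (mulr_ge0 (c0 _)).
have [h|h] := leP u (2 ^+ n * r).
  apply: le_trans (IH _) _; first by rewrite u0.
  by rewrite lerDl (mulr_ge0 (c0 _)).
have [uz|uz] := leP u z; last by rewrite andbF mulr0 addr_ge0// (mulr_ge0 (c0 _)).
rewrite un (le_trans (ltW h) uz) !andbT.
move: t0; case: (ltP 0 u) => u1 t0; last first.
  by rewrite mulr0 addr_ge0 ?(mulr_ge0 (c0 _)).
by rewrite !mulr1; apply: le_trans un _; rewrite lerDr.
Qed.

(** On shell k the integrand is at most 2^(k+1) r, the tail is evaluated at 2^k r, and the margin
    bound at 2^(k+1) r. Their product is C K q r^(1+al) (q / 4^m)^k with q = 2^(1+al), so the shells
    sum geometrically. *)
Lemma peeling (dD dX : measure_display) (D : measurableType dD)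
    (X : measurableType dX) (R : realType) (mu : probability D R)
    (Q : probability X R) (u : X -> R) (Z : D * X -> R)
    (al C K b : R) (m : nat) :
  0 <= al -> 0 < C -> 0 < K -> 0 < b -> 2 + al <= m%:R ->
  measurable_fun setT u -> (forall x, 0 <= u x <= 1) ->
  measurable_fun setT Z ->
  (forall r, 0 < r -> (Q [set x | 0 < u x <= r]%R <= (C * r `^ al)%:E)%E) ->
  (forall t, 0 < t -> {ae Q, forall x,
     (mu [set w | t <= Z (w, x)]%R <= (K / (b * t ^+ 2) ^+ m)%:E)%E}) ->
  (\int[mu]_w \int[Q]_x (u x * (0 < u x <= Z (w, x))%R%:R)%:E <=
    (C * (1 + 2 * K * 2 `^ (1 + al)) * b `^ (- ((1 + al) / 2)))%:E)%E.
Proof.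
move=> al0 C0 K0 b0 alm mu_ u01 mZ margin tail.
(* The scale with b r^2 = 1, at which the tail bounds start to be effective; r^(1+al) is then
   exactly the target rate. *)
pose r := b `^ (- 2^-1); have r0 : 0 < r by rewrite powR_gt0.
have br2 : b * r ^+ 2 = 1.
  rewrite -powR_mulrn ?(ltW r0)// -powRrM mulNr mulVf// powR_inv1 ?(ltW b0)//.
  by rewrite mulfV// gt_eqF.
have rE : r `^ (1 + al) = b `^ (- ((1 + al) / 2)).
  by rewrite -powRrM; congr (_ `^ _); field.
have r1E s : 0 < s -> s * s `^ al = s `^ (1 + al).
  by move=> s0; rewrite powRD ?powRr1 ?(ltW s0)// (gt_eqF s0) implybT.
pose q : R := 2 `^ (1 + al); have q0 : 0 < q by rewrite powR_gt0.
(* The ratio of the series over shells. It is at most 1/2 because 2q = 2^(2+al) <= 2^m <= 4^m, which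
   is where the size of m enters. *)
have q4 : q / 4 ^+ m <= 2^-1.
  rewrite ler_pdivrMr ?exprn_gt0// ler_pdivlMl//.
  have -> : 2 * q = 2 `^ (2 + al).
    by rewrite /q -r1E// mulrA powRD ?pnatr_eq0 ?implybT// powR_mulrn.
  apply: (@le_trans _ _ (2 ^+ m)).
    by rewrite -powR_mulrn// ler_powR// ler1n.
  by rewrite lerXn2r ?nnegrE// ler_nat.
(* Since u <= 1, finitely many shells cover its range. *)
have [n rn] : exists n, 1 <= 2 ^+ n * r.
  exists (Num.bound r^-1); rewrite -ler_pdivrMr// mul1r; apply: ltW.
  exact: upper_nthrootP.
have mf : measurable_fun setT (fun z : D * X => u z.2) by exact: measurableT_comp.
have mb r' : measurable_fun setT (fun z : D * X => 0 < u z.2 <= r').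
  by apply: measurable_and; [exact: measurable_fun_ltr|exact: measurable_fun_ler].
pose E k := [set z : D * X | (0 < u z.2 <= 2 ^+ k.+1 * r) && (2 ^+ k * r <= Z z)].
have mE k : measurable (E k).
  apply: measurable_bool_set; apply: measurable_and => //.
  exact: measurable_fun_ler.
pose E0 := [set z : D * X | 0 < u z.2 <= r].
have mE0 : measurable E0 by exact: measurable_bool_set.
pose h (z : D * X) := (u z.2 * (0 < u z.2 <= Z z)%R%:R)%:E.
have mA r' : measurable [set x | 0 < u x <= r']%R.
  apply: measurable_bool_set.
  by apply: measurable_and; [exact: measurable_fun_ltr|exact: measurable_fun_ler].
have u0 x : 0 <= u x by case/andP: (u01 x).
have mh : measurable_fun setT h.
  apply/measurable_EFinP; apply: measurable_funM => //.
  rewrite -indic_boolE; apply: measurable_indic; apply: measurable_bool_set.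
  by apply: measurable_and; [exact: measurable_fun_ltr|exact: measurable_fun_ler].
have h0 z : (0 <= h z)%E by rewrite lee_fin mulr_ge0.
have -> : (\int[mu]_w \int[Q]_x (u x * (0 < u x <= Z (w, x))%R%:R)%:E =
   \int[mu \x Q]_z h z)%E.
  by rewrite fubini_tonelli1.
pose g z : \bar R :=
  ((r * \1_E0 z)%:E + \sum_(k < n) (2 ^+ k.+1 * r * \1_(E k) z)%:E)%E.
have mi c F : measurable F ->
    measurable_fun setT (fun z : D * X => (c * \1_F z)%:E : \bar R).
  move=> mF; apply/measurable_EFinP.
  by apply: measurable_funM => //; exact: measurable_indic.
have i0 c F z : 0 <= c -> (0 <= ((c * \1_F z)%:E : \bar R))%E.
  by move=> c0; rewrite lee_fin mulr_ge0// indicE.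
have c0 k : 0 <= 2 ^+ k * r by rewrite mulr_ge0 ?exprn_ge0// ltW.
have int_i c F : 0 <= c -> measurable F ->
    (\int[mu \x Q]_z (c * \1_F z)%:E = c%:E * (mu \x Q) F)%E.
  move=> c0' mF; under eq_integral do rewrite EFinM.
  rewrite ge0_integralZl//; first by rewrite integral_indic// setIT.
  by apply/measurable_EFinP; exact: measurable_indic.
apply: (@le_trans _ _ (\int[mu \x Q]_z g z)%E).
  apply: ge0_le_integral => //.
  - apply: emeasurable_funD; first exact: mi.
    by apply: emeasurable_sum => k; exact: mi.
  move=> z _; rewrite /h /g sumEFin -EFinD lee_fin !indic_boolE.
  under eq_bigr do rewrite indic_boolE.
  apply: dyadic_peeling => //; rewrite u0/=; apply: le_trans rn.
  by case/andP: (u01 z.2).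
rewrite ge0_integralD//; last 4 first.
- by move=> z _; apply: i0; exact: ltW.
- exact: mi.
- by move=> z _; apply: sume_ge0 => k _; exact: i0.
- by apply: emeasurable_sum => k; exact: mi.
rewrite ge0_integral_sum//; last 2 first.
- by move=> k; exact: mi.
- by move=> k z _; exact: i0.
have bE0 : (\int[mu \x Q]_z (r * \1_E0 z)%:E <= (C * r `^ (1 + al))%:E)%E.
  rewrite int_i ?(ltW r0)//.
  (* For u <= r the probability over the sample is bounded by 1 and only the margin condition gives
     decay. *)
  apply: (@le_trans _ _ (r%:E * (1%:E * Q [set x | 0 < u x <= r]%R))%E).
    apply: lee_wpmul2l; first by rewrite lee_fin ltW.
    apply: product_measure_le => //; apply: aeW => x.
    exact: probability_le1 (measurable_ysection _ _).
  rewrite mul1e; apply: (@le_trans _ _ (r%:E * (C * r `^ al)%:E)%E).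
    by apply: lee_wpmul2l; [rewrite lee_fin ltW|exact: margin].
  by rewrite -EFinM lee_fin mulrCA r1E.
have bE k : (\int[mu \x Q]_z (2 ^+ k.+1 * r * \1_(E k) z)%:E <=
    (C * K * q * r `^ (1 + al) * 2^-1 ^+ k)%:E)%E.
  rewrite int_i//.
  have P0 : 0 < 2 ^+ k * r by rewrite mulr_gt0// exprn_gt0.
  have P1 : 0 < 2 ^+ k.+1 * r by rewrite mulr_gt0// exprn_gt0.
  pose c := K / (b * (2 ^+ k * r) ^+ 2) ^+ m.
  have c0' : 0 <= c.
    by rewrite divr_ge0 ?(ltW K0)// exprn_ge0// mulr_ge0 ?sqr_ge0// ltW.
  apply: (@le_trans _ _ ((2 ^+ k.+1 * r)%:E *
    (c%:E * Q [set x | 0 < u x <= 2 ^+ k.+1 * r]%R))%E).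
    apply: lee_wpmul2l; first by rewrite lee_fin ltW.
    apply: product_measure_le => //; first by move=> z /= /andP[].
    apply: filterS (tail _ P0) => x; apply: le_trans.
    apply: le_measure; rewrite ?inE//.
    - exact: measurable_ysection.
    - apply: measurable_bool_set; apply: measurable_fun_ler => //.
      by apply: measurableT_comp => //; exact: measurable_pair2.
    by move=> w; rewrite /ysection/= inE => /andP[].
  apply: (@le_trans _ _ ((2 ^+ k.+1 * r)%:E *
    (c%:E * (C * (2 ^+ k.+1 * r) `^ al)%:E))%E).
    apply: lee_wpmul2l; first by rewrite lee_fin ltW.
    by apply: lee_wpmul2l; [rewrite lee_fin|exact: margin].
  rewrite -!EFinM lee_fin.
  have -> : 2 ^+ k.+1 * r * (c * (C * (2 ^+ k.+1 * r) `^ al)) =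
     C * c * ((2 ^+ k.+1 * r) * (2 ^+ k.+1 * r) `^ al) by ring.
  rewrite r1E// powRM ?exprn_ge0 ?(ltW r0)//.
  have -> : (2 ^+ k.+1) `^ (1 + al) = q * q ^+ k.
    rewrite -exprS -(powR_mulrn k.+1 (ltW q0)) -(powR_mulrn k.+1 (ler0n R 2)).
    by rewrite /q -2!powRrM mulrC.
  (* Here b r^2 = 1 reduces the tail at 2^k r to K / 4^(m k). *)
  have -> : c = K * (4 ^+ m)^-1 ^+ k.
    have e4 : (2 : R) ^+ 2 = 4 by ring.
    by rewrite /c (exprMn _ (2 ^+ k)) mulrCA br2 mulr1 exprAC e4 exprAC exprVn.
  rewrite (_ : _ * _ = C * K * q * r `^ (1 + al) * (q / 4 ^+ m) ^+ k); last first.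
    by rewrite exprMn; ring.
  rewrite ler_wpM2l//.
    by rewrite !mulr_ge0 ?powR_ge0// ltW.
  by rewrite lerXn2r ?nnegrE ?divr_ge0 ?exprn_ge0 ?invr_ge0// ltW.
apply: (@le_trans _ _ ((C * r `^ (1 + al))%:E +
    \sum_(k < n) (C * K * q * r `^ (1 + al) * 2^-1 ^+ k)%:E)%E).
  by apply: leeD => //; apply: lee_sum.
rewrite sumEFin -EFinD lee_fin -mulr_sumr -rE -/q.
rewrite [leRHS](_ : _ = C * r `^ (1 + al) + C * K * q * r `^ (1 + al) * 2);
  last by ring.
rewrite lerD2l ler_wpM2l//.
  by rewrite !mulr_ge0 ?powR_ge0// ltW.
have /(congr1 -%R) := subrX1 (2^-1 : R) n.
set S := \sum_(i < n) _ => hS.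
have : 0 <= (2^-1 : R) ^+ n by rewrite exprn_ge0// invr_ge0.
by move: hS; lra.
Qed.

(** * Solvability and stability of the empirical threshold equation *)

Section empirical_threshold.
Context (R : realType) (N : nat) (x : 'I_N -> R).
Let avg (z : 'I_N -> R) := N%:R^-1 * \sum_(i < N) z i.
Let surplus t := avg (fun i => Num.max (x i - t) 0).

Let avg_le (y z : 'I_N -> R) : (forall i, y i <= z i) -> avg y <= avg z.
Proof. by move=> h; rewrite ler_wpM2l ?invr_ge0//; apply: ler_sum. Qed.

Let surplus_nonincreasing s t : s <= t -> surplus t <= surplus s.
Proof.
move=> st; apply: avg_le => i; rewrite ge_max !le_max lexx orbT andbT.
by rewrite lerD2l lerN2 st.
Qed.

(** As t grows, [t * avg x] increases strictly while the surplus does not increase, so there is at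
    most one root. The intermediate value theorem gives one between 0, where the surplus is
    nonnegative, and the sum of all [|x i|], where it vanishes whatever the signs of the [x i]. *)
Lemma empirical_threshold_unique : 0 < avg x ->
  exists t, unique (fun t => t * avg x = surplus t) t.
Proof.
move=> m0.
pose f t := t * avg x - surplus t.
pose B := \sum_(i < N) `|x i|.
have B0 : 0 <= B by apply: sumr_ge0.
have cf : continuous f.
  move=> t; apply: cvgB; first exact: mulrr_continuous.
  apply: cvgM; first exact: cvg_cst.
  apply: (cvg_big (op := +%R)) => [|i _]; first exact: add_continuous.
  apply: (@continuous_max R R (fun t => x i - t) (fun=> 0)); last exact: cvg_cst.
  by apply: cvgB; [exact: cvg_cst|exact: cvg_id].
have f0 : f 0 <= 0.
  rewrite /f mul0r sub0r oppr_le0; rewrite mulr_ge0 ?invr_ge0//.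
  by apply: sumr_ge0 => i _; rewrite le_max lexx orbT.
have fB : 0 <= f B.
  rewrite /f (_ : surplus B = 0); first by rewrite subr0 mulr_ge0// ltW.
  rewrite /surplus /avg big1 ?mulr0// => i _; apply: max_idPr.
  rewrite subr_le0 /B (bigD1 i)//=.
  by apply: le_trans (ler_norm _) _; rewrite lerDl sumr_ge0.
have [|t _ ft] := @IVT R f 0 B 0 B0 (continuous_subspaceT cf).
  by rewrite ge_min f0 le_max fB orbT.
exists t; split => [|s hs]; first by apply/eqP; rewrite -subr_eq0; apply/eqP.
have ht : t * avg x = surplus t by apply/eqP; rewrite -subr_eq0; apply/eqP.
apply/eqP; rewrite eq_le; apply/andP; split.
  rewrite leNgt; apply/negP => st; have := surplus_nonincreasing (ltW st).
  by rewrite -hs -ht ler_pM2r// leNgt st.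
rewrite leNgt; apply/negP => st; have := surplus_nonincreasing (ltW st).
by rewrite -hs -ht ler_pM2r// leNgt st.
Qed.

(** The difference of the two sides of the equation vanishes at t and has slope at least [avg x], so
    its value at s controls the distance. Replacing x by y at the fixed point s moves each of the
    two terms by at most [|x i - y i|], hence the factor 2. *)
Lemma empirical_threshold_dist (y : 'I_N -> R) (s t : R) :
  0 < avg x -> 0 <= s <= 1 -> t * avg x = surplus t ->
  `|t - s| * avg x <= 2 * avg (fun i => `|x i - y i|) +
    `|avg (fun i => s * y i - Num.max (y i - s) 0)|.
Proof.
move=> m0 /andP[s0 s1] ht.
have h1 : `|t - s| * avg x <= `|s * avg x - surplus s|.
  have [ts|ts] := leP s t.
    have := surplus_nonincreasing ts; rewrite -ht => h.
    rewrite (ger0_norm (_ : 0 <= t - s)) ?subr_ge0// -normrN.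
    by apply: le_trans (ler_norm _); rewrite mulrBl; lra.
  have := surplus_nonincreasing (ltW ts); rewrite -ht => h.
  rewrite (distrC t) (ger0_norm (_ : 0 <= s - t)) ?subr_ge0 ?(ltW ts)//.
  by apply: le_trans (ler_norm _); rewrite mulrBl; lra.
apply: le_trans h1 _.
have -> : s * avg x - surplus s = avg (fun i => s * x i - Num.max (x i - s) 0).
  by rewrite /surplus /avg mulrCA -mulrBr mulr_sumr -sumrB.
rewrite -lerBlDr; apply: le_trans (lerB_dist _ _) _.
rewrite /avg -mulrBr -sumrB normrM ger0_norm ?invr_ge0// mulrCA mulr_sumr.
rewrite ler_wpM2l ?invr_ge0//; apply: le_trans (ler_norm_sum _ _ _) _.
apply: ler_sum => i _.
have hs : `|s * (x i - y i)| <= `|x i - y i|.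
  by rewrite normrM ger0_norm// ler_piMl.
move: hs (ler_norm (x i - y i)) (ler_norm (y i - x i)).
rewrite (distrC (y i)) !ler_norml mulrBr => /andP[h2 h3] h4 h5.
by case: (leP (x i - s) 0); case: (leP (y i - s) 0) => *; apply/andP; split; lra.
Qed.

End empirical_threshold.

(** * The score compared with the optimal threshold *)

Section F1_score.
Context (R : realType) (d : nat) (P : probability (d.-tuple R * bool)%type R)
  (eta : d.-tuple R -> R) (theta p : R).

Lemma regression_label1 : regression_function P eta ->
  (P label1 = \int[lawX P]_x (eta x)%:E)%E.
Proof.
by case=> _ _ h; rewrite -h//; congr (P _); apply/seteqP; split => z /=; tauto.
Qed.

Lemma regression_classifier (g : d.-tuple R -> bool) :
  regression_function P eta -> measurable_fun setT g ->
  (\int[lawX P]_x (eta x * (g x)%:R)%:E = P [set z | label1 z /\ g z.1])%E.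
Proof.
case=> _ _ h mg; have mG : measurable [set x | g x] by exact: measurable_bool_set.
rewrite (_ : [set z | _] = [set z | [set x | g x] z.1 /\ label1 z]); last first.
  by apply/seteqP; split => z /= [].
rewrite h// [RHS]integral_mkcond epatch_indic; apply: eq_integral => x _.
by rewrite /= indic_boolE EFinM.
Qed.

Hypotheses (p0 : 0 < p) (pP : (p%:E <= P label1)%E)
  (heta : regression_function P eta) (htheta : optimal_threshold P eta theta).

Let mX : measurable_fun setT eta. Proof. by case: heta. Qed.

Let eta0 x : 0 <= eta x. Proof. by case: heta => _ /(_ x)/andP[]. Qed.

Let theta0 : 0 <= theta. Proof. by case: htheta => /andP[]. Qed.

Let mlabel : measurable (@label1 R d).
Proof. by apply: measurable_bool_set; exact: measurable_snd. Qed.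

Lemma le_fine_label1 : p <= fine (P label1).
Proof. by rewrite -lee_fin fineK// fin_num_measure. Qed.

Let m_ind (g : d.-tuple R -> bool) : measurable_fun setT g ->
  measurable_fun setT (fun x => (g x)%:R : R).
Proof.
move=> mg; rewrite -indic_boolE; apply: measurable_indic.
exact: measurable_bool_set.
Qed.

Let msurplus : measurable_fun setT (fun x => Num.max (eta x - theta) 0).
Proof.
by apply: measurable_maxr => //; exact: measurable_funB.
Qed.

(** The equation defining [theta] gives the surplus the integral theta P(Y = 1), which produces
    [theta] times the denominator of [F1 P g]. *)
Let int_right (g : d.-tuple R -> bool) : measurable_fun setT g ->
  (\int[lawX P]_x ((Num.max (eta x - theta) 0)%:E + (theta * (g x)%:R)%:E) =
   (theta * (fine (P label1) + fine (P [set z | g z.1])))%:E)%E.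
Proof.
move=> mg; have mG : measurable [set x | g x] by exact: measurable_bool_set.
rewrite ge0_integralD//; last 4 first.
- by move=> x _; rewrite lee_fin le_max lexx orbT.
- by apply/measurable_EFinP.
- by move=> x _; rewrite lee_fin mulr_ge0.
- by apply/measurable_EFinP; apply: measurable_funM => //; exact: m_ind.
case: htheta => _ <-; under [X in (_ + X)%E]eq_integral do rewrite EFinM.
rewrite ge0_integralZl//; last by apply/measurable_EFinP; exact: m_ind.
have -> : (\int[lawX P]_x ((g x)%:R)%:E = P [set z | g z.1])%E.
  transitivity (lawX P ([set x | g x] `&` setT)); last by rewrite setIT.
  by rewrite -integral_indic// indic_boolE.
rewrite mulrDr EFinD !EFinM !fineK ?fin_num_measure//.
by apply: measurable_bool_set; exact: measurableT_comp.
Qed.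

Let classifier_set (g : d.-tuple R -> bool) : measurable_fun setT g ->
  measurable [set z : d.-tuple R * bool | label1 z /\ g z.1].
Proof.
move=> mg; apply: measurableI => //; apply: measurable_bool_set.
exact: measurableT_comp.
Qed.

(** Integrate the pointwise inequality eta g <= max(eta - theta, 0) + theta g and divide by the
    denominator of the score. *)
Lemma F1_le_threshold (g : d.-tuple R -> bool) :
  measurable_fun setT g -> F1 P g <= theta.
Proof.
move=> mg; rewrite /F1 ler_pdivrMr; last first.
  by rewrite ltr_pwDl ?fine_ge0// (lt_le_trans p0)// le_fine_label1.
rewrite -lee_fin fineK ?fin_num_measure//; last exact: classifier_set.
rewrite -regression_classifier// -int_right//.
apply: ge0_le_integral => //.
- by move=> x _; rewrite lee_fin mulr_ge0.
- by apply/measurable_EFinP; apply: measurable_funM => //; exact: m_ind.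
- apply: emeasurable_funD; apply/measurable_EFinP => //.
  by apply: measurable_funM => //; exact: m_ind.
move=> x _; rewrite -EFinD lee_fin; case: (g x); rewrite ?mulr1 ?mulr0.
  by rewrite -lerBlDr le_max lexx.
by rewrite addr0 le_max lexx orbT.
Qed.

(** Here h is the slack in the converse of the pointwise inequality behind [F1_le_threshold];
    integrating that converse bounds the loss in score. *)
Lemma F1_ge_threshold (g : d.-tuple R -> bool) (h : d.-tuple R -> R) :
  measurable_fun setT g -> measurable_fun setT h ->
  (forall x, 0 <= h x) ->
  (forall x, Num.max (eta x - theta) 0 + theta * (g x)%:R <= eta x * (g x)%:R + h x) ->
  ((theta - F1 P g)%:E <= p^-1%:E * \int[lawX P]_x (h x)%:E)%E.
Proof.
move=> mg mh h0 hle.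
have L0 : 0 < fine (P label1) by rewrite (lt_le_trans p0)// le_fine_label1.
have D0 : 0 < fine (P label1) + fine (P [set z | g z.1]).
  by rewrite ltr_pwDl ?fine_ge0.
have I0 : (0 <= \int[lawX P]_x (h x)%:E)%E.
  by apply: integral_ge0 => x _; rewrite lee_fin.
have key : ((theta * (fine (P label1) + fine (P [set z | g z.1])))%:E <=
    (fine (P [set z | label1 z /\ g z.1]))%:E + \int[lawX P]_x (h x)%:E)%E.
  rewrite fineK ?fin_num_measure//; last exact: classifier_set.
  rewrite -regression_classifier// -int_right// -ge0_integralD//; last 4 first.
  - by move=> x _; rewrite lee_fin mulr_ge0.
  - by apply/measurable_EFinP; apply: measurable_funM => //; exact: m_ind.
  - by move=> x _; rewrite lee_fin.
  - exact/measurable_EFinP.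
  apply: ge0_le_integral => //.
  - by move=> x _; rewrite -EFinD lee_fin addr_ge0 ?mulr_ge0// le_max lexx orbT.
  - apply: emeasurable_funD; apply/measurable_EFinP => //.
    by apply: measurable_funM => //; exact: m_ind.
  - apply: emeasurable_funD; apply/measurable_EFinP => //.
    by apply: measurable_funM => //; exact: m_ind.
  by move=> x _; rewrite -!EFinD lee_fin.
(* If the slack has infinite integral, the right side is infinite and the bound is trivial. *)
move: I0 key; case: (\int[lawX P]_x (h x)%:E)%E => [r| |]// r0 key; last first.
  by rewrite gt0_muley ?leey// lte_fin invr_gt0.
rewrite -EFinM lee_fin; rewrite -EFinD lee_fin in key; rewrite lee_fin in r0.
rewrite /F1; move: key D0; set a := fine (P [set z | _ /\ _]).
set D := _ + fine _ => key D0.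
have Dp : p <= D by rewrite ler_wpDr ?fine_ge0// le_fine_label1.
(* The denominator D may be lowered to p because the gap theta - F1 is nonnegative by
   [F1_le_threshold]. *)
rewrite ler_pdivlMl// (le_trans (ler_wpM2r _ Dp))//.
  rewrite subr_ge0 ler_pdivrMr//.
  by have := F1_le_threshold mg; rewrite /F1 ler_pdivrMr.
by rewrite mulrBr mulrCA mulfV ?gt_eqF// mulr1 lerBlDr addrC mulrC.
Qed.

End F1_score.

(** * Marginals of the sample laws and measurability of the score *)

Lemma iid_law_tnth (d : measure_display) (T : measurableType d) (R : realType)
    (Q : probability T R) (N : nat) (i : 'I_N) (B : set T) : measurable B ->
  iid_law Q N [set s | B (tnth s i)] = Q B.
Proof.
move=> mB; pose A j := if j == i then B else setT.
rewrite (_ : [set s | _] = [set s | forall j, A j (tnth s j)]); last first.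
  apply/seteqP; split => s /=; last by move=> /(_ i); rewrite /A eqxx.
  by move=> Bs j; rewrite /A; case: eqP => // ->.
rewrite iid_lawE; last by move=> j; rewrite /A; case: ifP.
rewrite (bigD1 i)//= /A eqxx big1 ?mule1// => j /negbTE ->.
exact: probability_setT.
Qed.

(** Paired with the first component, one coordinate of the iid sample behaves like a fresh draw from
    Q. Bounds at a fixed x thereby reach the deviations at the unlabeled points. *)
Lemma product_iid_law_tnth (d1 d : measure_display) (T1 : measurableType d1)
    (T : measurableType d) (R : realType) (m1 : probability T1 R)
    (Q : probability T R) (N : nat) (i : 'I_N) (E : set (T1 * T)) :
  measurable E ->
  ((m1 \x iid_law Q N) [set z | E (z.1, tnth z.2 i)] = (m1 \x Q) E)%E.
Proof.
move=> mE; rewrite /product_measure1; apply: eq_integral => w _ /=.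
rewrite -(iid_law_tnth Q i); last exact: measurable_xsection.
by congr (iid_law _ _ _); apply/seteqP; split => s; rewrite /xsection/= !inE.
Qed.

Lemma product_measure_proj2 (d1 d : measure_display) (T1 : measurableType d1)
    (T : measurableType d) (R : realType) (m1 : probability T1 R)
    (m2 : probability T R) (B : set T) : measurable B ->
  ((m1 \x m2) [set z | B z.2] = m2 B)%E.
Proof.
move=> mB; rewrite (_ : [set z | _] = setT `*` B).
  by rewrite product_measure1E// [X in (X * _)%E]probability_setT mul1e.
by apply/seteqP; split => z /= => [|[]].
Qed.

Lemma product_measure_proj1 (d1 d : measure_display) (T1 : measurableType d1)
    (T : measurableType d) (R : realType) (m1 : probability T1 R)
    (m2 : probability T R) (B : set T1) : measurable B ->
  ((m1 \x m2) [set z | B z.1] = m1 B)%E.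
Proof.
move=> mB; rewrite (_ : [set z | _] = B `*` setT).
  by rewrite product_measure1E// [X in (_ * X)%E]probability_setT mule1.
by apply/seteqP; split => z /= => [|[]].
Qed.

Lemma measurable_F1 (R : realType) (d : nat) (dT : measure_display)
    (T : measurableType dT) (P : probability (d.-tuple R * bool)%type R)
    (g : T * d.-tuple R -> bool) : measurable_fun setT g ->
  measurable_fun setT (fun w => F1 P (fun x => g (w, x))).
Proof.
move=> mg; rewrite /F1.
have mG : measurable [set z : T * (d.-tuple R * bool) | g (z.1, z.2.1)].
  apply: measurable_bool_set; apply: measurableT_comp mg _.
  by apply: measurable_fun_pair => //; exact: measurableT_comp.
have mH : measurable [set z : T * (d.-tuple R * bool) | label1 z.2 /\ g (z.1, z.2.1)].
  apply: measurableI => //; apply: measurable_bool_set.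
  exact: (measurableT_comp measurable_snd measurable_snd).
have mP (E : set (T * (d.-tuple R * bool))) : measurable E ->
    measurable_fun setT (fun w => fine (P [set z | E (w, z)])).
  move=> mE; apply: (measurableT_comp (fine_measurable measurableT)).
  rewrite (_ : (fun w => _) = P \o xsection E); first exact: measurable_fun_xsection.
  by apply/funext => w; congr (P _); apply/seteqP; split => z; rewrite /xsection/= inE.
apply: measurable_funM; first exact: mP mH.
pose D w := fine (P label1) + fine (P [set z | g (w, z.1)]).
have mD : measurable_fun setT D by apply: measurable_funD => //; exact: mP mG.
suff : measurable_fun setT (fun w => (D w)^-1) by [].
(* Inversion agrees with the power -1 on nonnegative reals, including the value 0 at 0, and real
   powers are measurable. *)
have -> : (fun w => (D w)^-1) = (fun w => D w `^ (-1)).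
  by apply/funext => w; rewrite powR_inv1// addr_ge0 ?fine_ge0.
exact: (measurableT_comp (measurable_powR (-1)) mD).
Qed.

(** * Deterministic bounds on the excess score of a plug-in rule *)

(** If the rules s < f and t < e agree, the inequality already holds without the slack term. If they
    disagree, f - s and e - t have opposite signs, so |e - t| <= |f - e| + |s - t| <= z and the
    slack equals |e - t|. *)
Lemma plugin_gap (R : realDomainType) (e t f s z : R) :
  `|f - e| + `|s - t| <= z ->
  Num.max (e - t) 0 + t * (s < f)%R%:R <=
    e * (s < f)%R%:R + `|e - t| * (0 < `|e - t| <= z)%R%:R.
Proof.
move=> h; have h0 : 0 <= `|e - t| * (0 < `|e - t| <= z)%R%:R by rewrite mulr_ge0.
have u0 : `|e - t| <= z -> `|e - t| * (0 < `|e - t| <= z)%R%:R = `|e - t|.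
  move=> ->; rewrite andbT; have [//|u1] := ltP 0 `|e - t|; first by rewrite mulr1.
  by move: u1; rewrite normr_le0 => /eqP ->; rewrite normr0 mul0r.
have := h; move: (ler_norm (f - e)) (ler_norm (e - f)).
move: (ler_norm (s - t)) (ler_norm (t - s)).
rewrite (distrC t s) (distrC e f) => h1 h2 h3 h4 h5.
have [sf|fs] := ltP s f; rewrite ?mulr1 ?mulr0 ?addr0 ?add0r.
  have [et|te] := leP (e - t) 0; last by lra.
  have eN : `|e - t| = t - e by rewrite ler0_norm// opprB.
  rewrite u0 eN; lra.
have [//|te] := leP (e - t) 0.
have eN : `|e - t| = e - t by rewrite ger0_norm// ltW.
by rewrite u0 eN; lra.
Qed.

(** For b >= 1 the power b^-m is below the rate, since m exceeds (1 + al)/2. For b < 1 the rate is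
    at least 1 and [x <= 1] suffices. *)
Lemma le_powR_rate (R : realType) (x K b al : R) (m : nat) :
  0 <= al -> 0 <= K -> 0 < b -> 2 + al <= m%:R ->
  x <= 1 -> x <= K / b ^+ m -> x <= (1 + K) * b `^ (- ((1 + al) / 2)).
Proof.
move=> al0 K0 b0 alm x1 xK; have [b1|b1] := leP 1 b.
  apply: le_trans xK _.
  apply: (@le_trans _ _ (K * b `^ (- ((1 + al) / 2)))); last first.
    by rewrite ler_wpM2r ?powR_ge0// lerDr.
  rewrite ler_wpM2l// -powR_mulrn ?(ltW b0)// -powRN.
  by apply: ler_powR => //; lra.
apply: le_trans x1 _; rewrite -[leLHS]mulr1; apply: ler_pM => //.
  by rewrite lerDl.
rewrite powRN -[leLHS]invr1 lef_pV2 ?posrE ?powR_gt0//.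
rewrite -[leRHS](powRr0 b); apply: ger_powR; last by lra.
by rewrite b0 ltW.
Qed.

(** The two conditions at p / 4 keep the empirical mean of f above p - p/4 - p/4 = p/2. The
    empirical equation then has a unique root, s is that root, and its distance to [theta] is at
    most (2/p)(2S + T). *)
Lemma plugin_excess_le (R : realType) (d : nat)
    (P : probability (d.-tuple R * bool)%type R) (eta f : d.-tuple R -> R)
    (gstar : d.-tuple R -> bool) (theta p s : R) (N : nat)
    (DN : N.-tuple (d.-tuple R)) (S T : R) :
  0 < p -> (p%:E <= P label1)%E -> regression_function P eta ->
  optimal_threshold P eta theta -> measurable_fun setT gstar ->
  measurable_fun setT f -> (0 < N)%N ->
  (forall t, unique (empirical_threshold_eq f DN) t -> s = t) ->
  S = N%:R^-1 * \sum_(i < N) `|f (tnth DN i) - eta (tnth DN i)| ->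
  T = `|N%:R^-1 * \sum_(i < N) (theta * eta (tnth DN i) -
                          Num.max (eta (tnth DN i) - theta) 0)| ->
  N%:R^-1 * \sum_(i < N) (fine (P label1) - eta (tnth DN i)) < p / 4 ->
  S < p / 4 ->
  ((excess_F1 P gstar (plugin_classifier f s))%:E <=
   p^-1%:E * \int[lawX P]_x (`|eta x - theta| *
     (0 < `|eta x - theta| <=
        `|f x - eta x| + 2 / p * (2 * S + T))%R%:R)%:E)%E.
Proof.
move=> p0 pP heta htheta mgstar mf N0 hs ES ET hL hS.
have NR : (0 : R) < N%:R by rewrite ltr0n.
have theta01 : 0 <= theta <= 1 by case: htheta.
have mg : measurable_fun setT (plugin_classifier f s) by exact: measurable_fun_ltr.
have meta : measurable_fun setT eta by case: heta.
have T0 : 0 <= T by rewrite ET.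
have S0 : 0 <= S by rewrite ES mulr_ge0 ?invr_ge0// sumr_ge0.
have avgf : p / 2 <= N%:R^-1 * \sum_(i < N) f (tnth DN i).
  have hLp := le_fine_label1 pP.
  move: hL; rewrite sumrB sumr_const card_ord -[X in X - _]mulr_natl mulrBr.
  rewrite mulKf ?gt_eqF// => hL.
  have : N%:R^-1 * \sum_(i < N) eta (tnth DN i) <=
      N%:R^-1 * \sum_(i < N) f (tnth DN i) + S.
    rewrite ES -mulrDr -big_split/= ler_wpM2l ?invr_ge0//.
    apply: ler_sum => i _; rewrite -lerBlDl distrC; exact: ler_norm.
  by move: hS hLp hL; lra.
have avg0 : 0 < N%:R^-1 * \sum_(i < N) f (tnth DN i).
  by apply: lt_le_trans avgf; rewrite divr_gt0.
have [t ht] := empirical_threshold_unique avg0.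
have st := hs t ht; subst t.
have dist : `|s - theta| <= 2 / p * (2 * S + T).
  have := empirical_threshold_dist (fun i => eta (tnth DN i)) avg0 theta01 (proj1 ht).
  rewrite -ES -ET => h; rewrite mulrAC ler_pdivlMr//.
  have := ler_wpM2l (normr_ge0 (s - theta)) avgf; lra.
apply: (@le_trans _ _ (theta - F1 P (plugin_classifier f s))%:E).
  by rewrite lee_fin /excess_F1 lerB// (F1_le_threshold p0 pP heta htheta).
apply: (F1_ge_threshold p0 pP heta htheta) => //.
- apply: measurable_funM.
    by apply: measurableT_comp => //; exact: measurable_funB.
  rewrite -indic_boolE; apply: measurable_indic; apply: measurable_bool_set.
  apply: measurable_and.
    apply: measurable_fun_ltr => //.
    by apply: measurableT_comp => //; exact: measurable_funB.
  apply: measurable_fun_ler.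
    by apply: measurableT_comp => //; exact: measurable_funB.
  apply: measurable_funD => //.
  by apply: measurableT_comp => //; exact: measurable_funB.
by move=> x; apply: plugin_gap; rewrite lerD2l.
Qed.

(** The trivial bound for bad samples: the optimal score is at most [theta <= 1] and scores are
    nonnegative. *)
Lemma excess_F1_le1 (R : realType) (d : nat)
    (P : probability (d.-tuple R * bool)%type R) (eta : d.-tuple R -> R)
    (gstar g : d.-tuple R -> bool) (theta p : R) :
  0 < p -> (p%:E <= P label1)%E -> regression_function P eta ->
  optimal_threshold P eta theta -> measurable_fun setT gstar ->
  excess_F1 P gstar g <= 1.
Proof.
move=> p0 pP heta htheta mgstar; have /andP[_ t1] := proj1 htheta.
have := F1_le_threshold p0 pP heta htheta mgstar.
have : 0 <= F1 P g by rewrite /F1 divr_ge0 ?addr_ge0 ?fine_ge0.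
by rewrite /excess_F1; lra.
Qed.

(** * Polynomial tails of the sample statistics *)

Section plugin_tails.
Context (R : realType) (dW dX : measure_display) (W : measurableType dW)
  (X : measurableType dX) (mu : probability W R) (Q : probability X R)
  (N m : nat) (b : R).
Hypotheses (N0 : (0 < N)%N) (m0 : (0 < m)%N) (b0 : 0 < b) (bN : b <= N%:R).

(** Integrating the almost-everywhere bound over x gives each term the tail of D under the product
    of [mu] and [Q]. The terms share the component [z.1], so they are averaged with
    [tail_average]. *)
Lemma tail_average_iid (D : W * X -> R) (K : R) : 0 < K ->
  measurable_fun setT D -> (forall z, 0 <= D z) ->
  (forall t, 0 < t -> {ae Q, forall x,
     (mu [set w | t <= D (w, x)]%R <= (K / (b * t ^+ 2) ^+ m)%:E)%E}) ->
  forall t, 0 < t ->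
    ((mu \x iid_law Q N)
       [set z | t <= N%:R^-1 * \sum_(i < N) D (z.1, tnth z.2 i)]%R <=
     (4 * 4 ^+ m * K / (b * t ^+ 2) ^+ m)%:E)%E.
Proof.
move=> K0 mD D0 tailD t t0.
have mt i : measurable_fun setT (fun z : W * N.-tuple X => (z.1, tnth z.2 i)).
  apply: measurable_fun_pair => //.
  exact: (measurableT_comp (measurable_tnth i) measurable_snd).
apply: tail_average => // [i|{t0} {}t t0 i].
  exact: (measurableT_comp mD (mt i)).
have mE : measurable [set z | t <= D z]%R.
  by apply: measurable_bool_set; exact: measurable_fun_ler.
rewrite [leLHS](product_iid_law_tnth mu Q i mE).
apply: (@le_trans _ _ ((K / (b * t ^+ 2) ^+ m)%:E * Q setT)%E); last first.
  by rewrite [X in (_ * X)%E]probability_setT mule1.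
apply: product_measure_le => //.
  by rewrite divr_ge0 ?exprn_ge0 ?mulr_ge0 ?sqr_ge0 ?ltW.
apply: filterS (tailD t t0) => x; apply: le_trans.
rewrite (_ : ysection _ x = [set w | t <= D (w, x)]%R)//.
by apply/seteqP; split => w; rewrite /ysection/= inE.
Qed.

(** The bound exp(-N t^2/9) is at most (9 m / (N t^2))^m, and b <= N replaces N by b. *)
Lemma tail_hoeffding (V : X -> R) : measurable_fun setT V ->
  (forall x, `|V x| <= 1) -> (\int[Q]_x (V x)%:E <= 0)%E ->
  forall t, 0 < t ->
    ((mu \x iid_law Q N) [set z | t <= N%:R^-1 * \sum_(i < N) V (tnth z.2 i)]%R
     <= (9 ^+ m * m%:R ^+ m / (b * t ^+ 2) ^+ m)%:E)%E.
Proof.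
move=> mV V1 V0 t t0; have NR : (0 : R) < N%:R by rewrite ltr0n.
pose B : set (N.-tuple X) := [set s | t <= N%:R^-1 * \sum_(i < N) V (tnth s i)]%R.
rewrite [leLHS](@product_measure_proj2 _ _ _ _ _ mu (iid_law Q N) B); last first.
  apply: measurable_bool_set; apply: measurable_fun_ler => //.
  apply: measurable_funM => //; apply: measurable_sum => i.
  by apply: measurableT_comp => //; exact: measurable_tnth.
apply: le_trans (hoeffding mV V1 V0 N0 t0) _; rewrite lee_fin.
have t20 : 0 < t ^+ 2 by rewrite exprn_gt0.
apply: le_trans (expRN_le_poly m0 _) _; first by rewrite mulr_gt0// divr_gt0.
rewrite mulrA expr_div_n invf_div mulrA [_ ^+ m * 9 ^+ m]mulrC.
rewrite ler_wpM2l ?mulr_ge0 ?exprn_ge0//.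
rewrite lef_pV2 ?posrE ?exprn_gt0 ?mulr_gt0//.
apply: lerXn2r; rewrite ?nnegrE; [exact: mulr_ge0 (ltW b0) (ltW t20)|
  exact: mulr_ge0 (ltW NR) (ltW t20)|by rewrite ler_pM2r].
Qed.

Lemma tail_hoeffding_norm (V : X -> R) : measurable_fun setT V ->
  (forall x, `|V x| <= 1) -> (\int[Q]_x (V x)%:E = 0)%E ->
  forall t, 0 < t ->
    ((mu \x iid_law Q N) [set z | t <= `|N%:R^-1 * \sum_(i < N) V (tnth z.2 i)|]%R
     <= (2 * (9 ^+ m * m%:R ^+ m) / (b * t ^+ 2) ^+ m)%:E)%E.
Proof.
move=> mV V1 V0 t t0.
have mavg (U : X -> R) : measurable_fun setT U ->
    measurable_fun setT
      (fun z : W * N.-tuple X => N%:R^-1 * \sum_(i < N) U (tnth z.2 i)).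
  move=> mU; apply: measurable_funM => //; apply: measurable_sum => i.
  apply: (measurableT_comp mU).
  exact: (measurableT_comp (measurable_tnth i) measurable_snd).
have mset (U : X -> R) : measurable_fun setT U -> measurable
    [set z : W * N.-tuple X | t <= N%:R^-1 * \sum_(i < N) U (tnth z.2 i)]%R.
  move=> mU; apply: measurable_bool_set; apply: measurable_fun_ler => //.
  exact: mavg.
have mNV : measurable_fun setT (fun x => - V x) by exact: measurableT_comp.
apply: (@le_trans _ _ ((mu \x iid_law Q N)%E
  ([set z | t <= N%:R^-1 * \sum_(i < N) V (tnth z.2 i)]%R `|`
   [set z | t <= N%:R^-1 * \sum_(i < N) - V (tnth z.2 i)]%R))).
  apply: le_measure; rewrite ?inE.
  - apply: measurable_bool_set; apply: measurable_fun_ler => //.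
    exact: (measurableT_comp (@normr_measurable R setT) (mavg V mV)).
  - exact: measurableU (mset _ mV) (mset _ mNV).
  move=> z /=; rewrite sumrN mulrN ler_normr => /orP[]; [by left|by right].
apply: le_trans (measureU2 _ (mset _ mV) (mset _ mNV)) _.
rewrite -mulrA mulr_natl mulr2n EFinD; apply: leeD.
  by apply: tail_hoeffding => //; rewrite V0.
apply: (@tail_hoeffding (fun x => - V x)) => // [x|]; first by rewrite normrN.
have iV := bounded_integrable Q mV V1.
under eq_integral do rewrite -mulN1r EFinM.
by rewrite integralZl// V0 mule0.
Qed.

End plugin_tails.

Lemma tail_scale (R : realFieldType) (K b c t : R) (m : nat) :
  K / (b * (c * t) ^+ 2) ^+ m = K * (c ^- 2) ^+ m / (b * t ^+ 2) ^+ m.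
Proof.
by rewrite (exprMn _ c) mulrCA (exprMn _ (c ^+ 2)) invfM -exprVn mulrA.
Qed.

(** * The constant and the expected excess *)

Section rate.
Context (R : realType) (alpha C0 delta0 C1 C2 p : R).
Hypotheses (alpha0 : 0 <= alpha) (C0_gt0 : 0 < C0) (delta0_gt0 : 0 < delta0)
  (C1_gt0 : 0 < C1) (C2_gt0 : 0 < C2) (p0 : 0 < p).

(** The common exponent of all tails. [K1], [K2], [K3] and [KZ] are the tail constants of the
    pointwise deviation, of its average [S], of a one-sided Hoeffding mean and of the peeling radius
    [Z]. *)
Let m : nat := Num.bound (2 + alpha).
Let K1 : R := C1 * m%:R ^+ m / C2 ^+ m.
Let K2 : R := 4 * 4 ^+ m * K1.
Let K3 : R := 9 ^+ m * m%:R ^+ m.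
Let KZ : R := K1 * (2^-1 ^- 2) ^+ m + K2 * ((p / 16) ^- 2) ^+ m +
  2 * K3 * ((p / 8) ^- 2) ^+ m.
(* With this constant the margin bound holds for all radii, not just those
   below delta0. *)
Let C0' : R := C0 + (delta0 `^ alpha)^-1.
(** One summand each for the samples with [p / 4 <= A w], for those with [p / 4 <= S w], and for the
    peeling bound. *)
Definition rate_constant : R :=
  (1 + K3 * ((p / 4) ^- 2) ^+ m) + (1 + K2 * ((p / 4) ^- 2) ^+ m) +
  p^-1 * (C0' * (1 + 2 * KZ * 2 `^ (1 + alpha))).

Let alpham : 2 + alpha <= m%:R.
Proof. by apply: ltW; apply: archi_boundP; rewrite addr_ge0. Qed.

Let m0 : (0 < m)%N.
Proof. by rewrite -(ltr0n R); apply: lt_le_trans alpham; rewrite ltr_pwDl. Qed.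

Let K1_gt0 : 0 < K1.
Proof. by rewrite divr_gt0 ?mulr_gt0 ?exprn_gt0 ?ltr0n. Qed.

Let K2_gt0 : 0 < K2.
Proof. by apply: mulr_gt0 => //; rewrite mulr_gt0 ?exprn_gt0. Qed.

Let K3_gt0 : 0 < K3.
Proof. by rewrite mulr_gt0 ?exprn_gt0 ?ltr0n. Qed.

Let scale_ge0 (c : R) : 0 <= (c ^- 2) ^+ m.
Proof. by rewrite exprn_ge0// invr_ge0 sqr_ge0. Qed.

Let KZ_gt0 : 0 < KZ.
Proof.
have h1 : 0 < K1 * (2^-1 ^- 2) ^+ m.
  by apply: mulr_gt0 => //; rewrite exprn_gt0 ?invr_gt0 ?exprn_gt0 ?invr_gt0.
have h2 : 0 <= K2 * ((p / 16) ^- 2) ^+ m by apply: mulr_ge0; [exact: ltW|].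
have h3 : 0 <= 2 * K3 * ((p / 8) ^- 2) ^+ m.
  by apply: mulr_ge0 => //; apply: mulr_ge0 => //; exact: ltW.
by rewrite /KZ; lra.
Qed.

Let C0'_gt0 : 0 < C0'.
Proof. by rewrite ltr_pwDl// invr_ge0 powR_ge0. Qed.

Lemma rate_constant_gt0 : 0 < rate_constant.
Proof.
have h1 : 0 <= K3 * ((p / 4) ^- 2) ^+ m by apply: mulr_ge0 => //; exact: ltW.
have h2 : 0 <= K2 * ((p / 4) ^- 2) ^+ m by apply: mulr_ge0 => //; exact: ltW.
have h3 : 0 <= p^-1 * (C0' * (1 + 2 * KZ * 2 `^ (1 + alpha))).
  apply: mulr_ge0; first by rewrite invr_ge0 ltW.
  apply: mulr_ge0; first exact: ltW.
  apply: addr_ge0 => //; apply: mulr_ge0; last exact: powR_ge0.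
  by apply: mulr_ge0 => //; exact: ltW.
by rewrite /rate_constant; lra.
Qed.

Section estimator.
Context (d : nat) (P : probability (d.-tuple R * bool)%type R)
  (eta : d.-tuple R -> R) (theta : R) (gstar : d.-tuple R -> bool) (n N : nat)
  (a : R) (etahat : n.-tuple (d.-tuple R * bool) -> d.-tuple R -> R)
  (thetahat : n.-tuple (d.-tuple R * bool) * N.-tuple (d.-tuple R) -> R).
Hypotheses (pP : (p%:E <= P label1)%E) (heta : regression_function P eta)
  (htheta : optimal_threshold P eta theta) (hgstar : F1_optimal P gstar)
  (margin : margin_assumption P eta theta alpha C0 delta0)
  (N0 : (0 < N)%N) (a0 : 0 < a)
  (metahat : measurable_fun setT
    (fun z : n.-tuple (d.-tuple R * bool) * d.-tuple R => etahat z.1 z.2))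
  (tail : forall t : R, 0 < t ->
      {ae lawX P, forall x,
        (iid_law P n [set Dn | (t <= `|etahat Dn x - eta x|)%R]
           <= (C1 * expR (- (C2 * a * t ^+ 2)))%:E)%E})
  (hthetahat : plugin_threshold etahat thetahat).

Let b : R := Num.min a N%:R.
Let b0 : 0 < b. Proof. by rewrite lt_min a0 ltr0n. Qed.
Let ba : b <= a. Proof. by rewrite ge_min lexx. Qed.
Let bN : b <= N%:R. Proof. by rewrite ge_min lexx orbT. Qed.

Let dev (z : n.-tuple (d.-tuple R * bool) * d.-tuple R) := `|etahat z.1 z.2 - eta z.2|.
(** This function has mean zero under [lawX P] because [theta] solves the population threshold
    equation. *)
Let V x := theta * eta x - Num.max (eta x - theta) 0.
Let sample := (n.-tuple (d.-tuple R * bool) * N.-tuple (d.-tuple R))%type.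
Let S (w : sample) := N%:R^-1 * \sum_(i < N) dev (w.1, tnth w.2 i).
Let T (w : sample) := `|N%:R^-1 * \sum_(i < N) V (tnth w.2 i)|.
Let L := fine (P label1).
Let A (w : sample) := N%:R^-1 * \sum_(i < N) (L - eta (tnth w.2 i)).
Let Z (z : sample * d.-tuple R) :=
  dev (z.1.1, z.2) + 2 / p * (2 * S z.1 + T z.1).
Let mu : probability sample R := (iid_law P n \x iid_law (lawX P) N)%E.
Let rate := b `^ (- ((1 + alpha) / 2)).

Let meta : measurable_fun setT eta. Proof. by case: heta. Qed.
Let eta01 x : 0 <= eta x <= 1. Proof. by case: heta. Qed.
Let theta01 : 0 <= theta <= 1. Proof. by case: htheta. Qed.

Let mdev : measurable_fun setT dev.
Proof.
apply: measurableT_comp => //; apply: measurable_funB => //.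
exact: (measurableT_comp meta measurable_snd).
Qed.

Let mtnth i : measurable_fun setT (fun w : sample => tnth w.2 i).
Proof. exact: (measurableT_comp (measurable_tnth i) measurable_snd). Qed.

Let mavg (f : sample -> 'I_N -> R) : (forall i, measurable_fun setT (f^~ i)) ->
  measurable_fun setT (fun w => N%:R^-1 * \sum_(i < N) f w i).
Proof. by move=> mf; apply: measurable_funM => //; exact: measurable_sum. Qed.

Let mS : measurable_fun setT S.
Proof.
apply: mavg => i; apply: (measurableT_comp mdev).
by apply: measurable_fun_pair => //; exact: mtnth.
Qed.

Let mV : measurable_fun setT V.
Proof.
apply: measurable_funB; first exact: measurable_funM.
by apply: measurable_maxr => //; exact: measurable_funB.
Qed.

Let mT : measurable_fun setT T.
Proof.
apply: (measurableT_comp (@normr_measurable R setT)).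
by apply: mavg => i; exact: (measurableT_comp mV (mtnth i)).
Qed.

Let mA : measurable_fun setT A.
Proof.
apply: mavg => i; apply: measurable_funB => //.
exact: (measurableT_comp meta (mtnth i)).
Qed.

Let mZ : measurable_fun setT Z.
Proof.
apply: measurable_funD.
  apply: (measurableT_comp mdev); apply: measurable_fun_pair => //.
  exact: (measurableT_comp measurable_fst measurable_fst).
apply: measurable_funM => //; apply: measurable_funD.
  by apply: measurable_funM => //; exact: (measurableT_comp mS measurable_fst).
exact: (measurableT_comp mT measurable_fst).
Qed.

Let mge (f : sample -> R) t : measurable_fun setT f -> measurable [set w | t <= f w].
Proof. by move=> mf; apply: measurable_bool_set; exact: measurable_fun_ler. Qed.

Let Lint : (L%:E = \int[lawX P]_x (eta x)%:E)%E.
Proof.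
rewrite -regression_label1// fineK// fin_num_measure//.
by apply: measurable_bool_set; exact: measurable_snd.
Qed.

Let tail_dev t : 0 < t -> {ae lawX P, forall x,
  (iid_law P n [set Dn | t <= dev (Dn, x)]%R <= (K1 / (b * t ^+ 2) ^+ m)%:E)%E}.
Proof.
move=> t0; apply: filterS (tail t0) => x /le_trans; apply; rewrite lee_fin.
have t20 : 0 < t ^+ 2 by rewrite exprn_gt0.
have y0 : 0 < C2 * a * t ^+ 2 by rewrite !mulr_gt0.
apply: le_trans (ler_wpM2l (ltW C1_gt0) (expRN_le_poly m0 y0)) _.
rewrite /K1 -[leRHS]mulrA -invfM -exprMn mulrA.
rewrite ler_wpM2l ?mulr_ge0 ?exprn_ge0 ?(ltW C1_gt0)//.
rewrite lef_pV2 ?posrE ?exprn_gt0 ?mulr_gt0//.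
apply: lerXn2r; rewrite ?nnegrE; [by rewrite !mulr_ge0 ?ltW|by rewrite ltW|].
by rewrite -mulrA ler_pM2l// ler_pM2r.
Qed.

Let tail_S t : 0 < t -> (mu [set w | t <= S w]%R <= (K2 / (b * t ^+ 2) ^+ m)%:E)%E.
Proof.
move=> t0; apply: (tail_average_iid N0 m0 b0 K1_gt0 mdev _ tail_dev t0) => z.
exact: normr_ge0.
Qed.

Let tail_T t : 0 < t -> (mu [set w | t <= T w]%R <= (2 * K3 / (b * t ^+ 2) ^+ m)%:E)%E.
Proof.
have pos x : 0 <= Num.max (eta x - theta) 0 by rewrite le_max lexx orbT.
have V1 x : `|V x| <= 1.
  rewrite /V; have := eta01 x; have := theta01 => /andP[t1 t2] /andP[e1 e2].
  by rewrite ler_norml; case: (leP (eta x - theta) 0) => h; apply/andP; split; nra.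
have V0 : (\int[lawX P]_x (V x)%:E = 0)%E.
  rewrite /V; under eq_integral do rewrite EFinB.
  have ieta : (lawX P).-integrable setT (fun x => (theta * eta x)%:E).
    apply: (@bounded_integrable _ _ _ _ (fun x => theta * eta x)).
      exact: measurable_funM.
    by move=> x; have := eta01 x; have := theta01; rewrite ler_norml; nra.
  have imax : (lawX P).-integrable setT (fun x => (Num.max (eta x - theta) 0)%:E).
    apply: (@bounded_integrable _ _ _ _ (fun x => Num.max (eta x - theta) 0)).
      by apply: measurable_maxr => //; exact: measurable_funB.
    move=> x; rewrite ger0_norm// ge_max ler01 andbT.
    by have := eta01 x; have := theta01; lra.
  rewrite integralB//; case: htheta => _ <-.
  under eq_integral do rewrite EFinM.
  rewrite ge0_integralZl//; last 3 first.
  - exact/measurable_EFinP.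
  - by move=> x _; rewrite lee_fin; case/andP: (eta01 x).
  - by rewrite lee_fin; case/andP: theta01.
  rewrite -regression_label1// subee// fin_numM// fin_num_measure//.
  by apply: measurable_bool_set; exact: measurable_snd.
exact: (tail_hoeffding_norm (iid_law P n) N0 m0 b0 bN mV V1 V0).
Qed.

Let tail_A t : 0 < t -> (mu [set w | t <= A w]%R <= (K3 / (b * t ^+ 2) ^+ m)%:E)%E.
Proof.
move=> t0; have L0 : 0 <= L by rewrite fine_ge0.
have L1 : L <= 1.
  rewrite -lee_fin /L fineK ?fin_num_measure ?probability_le1//;
    by apply: measurable_bool_set; exact: measurable_snd.
have mD : measurable_fun setT (fun x => L - eta x) by exact: measurable_funB.
have D1 x : `|L - eta x| <= 1 by have := eta01 x; rewrite ler_norml; lra.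
have D0 : (\int[lawX P]_x (L - eta x)%:E <= 0)%E.
  under eq_integral do rewrite EFinB.
  have ieta : (lawX P).-integrable setT (EFin \o eta).
    apply: bounded_integrable => // x.
    by have := eta01 x; rewrite ler_norml; lra.
  rewrite integralB//; last exact: finite_measure_integrable_cst.
  rewrite integral_cst// [X in (_ * X)%E]probability_setT mule1 -Lint subee//.
exact: (tail_hoeffding (iid_law P n) N0 m0 b0 bN mD D1 D0 t0).
Qed.

Let tail_Z t : 0 < t -> {ae lawX P, forall x,
  (mu [set w | t <= Z (w, x)]%R <= (KZ / (b * t ^+ 2) ^+ m)%:E)%E}.
Proof.
(* The budget for t: one half goes to the pointwise deviation, and the levels p t/16 for [S] and p
   t/8 for [T] make up the other half, as (2/p)(2 p/16 + p/8) = 1/2. *)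
move=> t0; have h1 : 0 < 2^-1 * t by rewrite mulr_gt0.
have h2 : 0 < p / 16 * t by rewrite mulr_gt0// divr_gt0.
have h3 : 0 < p / 8 * t by rewrite mulr_gt0// divr_gt0.
apply: filterS (tail_dev h1) => x hx.
have mD : measurable [set Dn | 2^-1 * t <= dev (Dn, x)]%R.
  apply: measurable_bool_set; apply: measurable_fun_ler => //.
  exact: (measurableT_comp mdev (measurable_pair2 x)).
have mD' : measurable [set w : sample | 2^-1 * t <= dev (w.1, x)]%R.
  apply: measurable_bool_set; apply: measurable_fun_ler => //.
  apply: (measurableT_comp mdev); exact: measurable_fun_pair.
apply: (@le_trans _ _ (mu ([set w | 2^-1 * t <= dev (w.1, x)]%R `|`
    [set w | p / 16 * t <= S w]%R `|` [set w | p / 8 * t <= T w]%R))).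
  apply: le_measure; rewrite ?inE.
  - apply: mge; exact: (measurableT_comp mZ (measurable_pair2 x)).
  - by do 2? apply: measurableU => //; exact: mge.
  move=> w /=; rewrite /Z/= => tZ.
  have [|h4] := leP (2^-1 * t) (dev (w.1, x)); first by left; left.
  have [|h5] := leP (p / 16 * t) (S w); first by left; right.
  right; rewrite leNgt; apply/negP => h6.
  have : 2 * S w + T w < p / 4 * t by lra.
  rewrite -(ltr_pM2l (_ : 0 < 2 / p)) ?divr_gt0//.
  have -> : 2 / p * (p / 4 * t) = 2^-1 * t by field; rewrite gt_eqF.
  lra.
apply: le_trans (measureU2 _ _ _) _; [exact: measurableU (mD') (mge _ mS)|exact: mge|].
rewrite /KZ 2!mulrDl !EFinD; apply: leeD; last first.
  by rewrite -tail_scale; exact: tail_T.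
apply: le_trans (measureU2 _ mD' (mge _ mS)) _; apply: leeD; last first.
  by rewrite -tail_scale; exact: tail_S.
by rewrite -tail_scale [leLHS](product_measure_proj1 _ _ mD).
Qed.

Let bad_le (B : set sample) K t : measurable B -> 0 < K -> 0 < t ->
  (mu B <= (K / (b * t ^+ 2) ^+ m)%:E)%E ->
  (mu B <= ((1 + K * (t ^- 2) ^+ m) * rate)%:E)%E.
Proof.
move=> mB K0 t0; have : (mu B <= 1)%E by exact: probability_le1.
have : (0 <= mu B)%E by [].
case: (mu B) => [r| |]//; rewrite !lee_fin => r0 r1 rK.
apply: le_powR_rate b0 alpham r1 _ => //; first by rewrite mulr_ge0// ltW.
by move: rK; rewrite -[t]mulr1 tail_scale expr1n mulr1 mulr1.
Qed.

(** Beyond [delta0] a probability is at most 1, and 1 <= (r / delta0)^alpha because alpha >= 0. *)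
Let margin_all r : 0 < r ->
  (lawX P [set x | 0 < `|eta x - theta| <= r]%R <= (C0' * r `^ alpha)%:E)%E.
Proof.
move=> r0; have [rd|rd] := leP r delta0.
  apply: le_trans (margin _) _; first by rewrite r0.
  by rewrite lee_fin ler_wpM2r ?powR_ge0// lerDl invr_ge0 powR_ge0.
have mm : measurable [set x | 0 < `|eta x - theta| <= r]%R.
  have mn : measurable_fun setT (fun x => `|eta x - theta|).
    by apply: measurableT_comp => //; exact: measurable_funB.
  apply: measurable_bool_set.
  by apply: measurable_and; [exact: measurable_fun_ltr|exact: measurable_fun_ler].
apply: le_trans (probability_le1 _ mm) _; rewrite lee_fin mulrDl.
rewrite ler_wpDl ?mulr_ge0 ?powR_ge0 ?(ltW C0_gt0)//.
rewrite ler_pdivlMl ?powR_gt0// mulr1.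
by apply: ge0_ler_powR => //; rewrite ?nnegrE ltW.
Qed.

Lemma expected_excess_le :
  (\int[mu]_D
      (excess_F1 P gstar (plugin_classifier (etahat D.1) (thetahat D)))%:E
   <= (rate_constant * (a `^ (- ((1 + alpha) / 2)) +
                        N%:R `^ (- ((1 + alpha) / 2))))%:E)%E.
Proof.
have [mgstar gopt] := hgstar; have [mthetahat uthetahat] := hthetahat.
have p40 : 0 < p / 4 by rewrite divr_gt0.
pose B1 := [set w | p / 4 <= A w]; pose B2 := [set w | p / 4 <= S w].
have mB1 : measurable B1 by exact: mge.
have mB2 : measurable B2 by exact: mge.
pose I w := (\int[lawX P]_x (`|eta x - theta| *
  (0 < `|eta x - theta| <= Z (w, x))%R%:R)%:E)%E.
have mu_abs : measurable_fun setT (fun x => `|eta x - theta|).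
  by apply: measurableT_comp => //; exact: measurable_funB.
have I0 w : (0 <= I w)%E by apply: integral_ge0 => x _; rewrite lee_fin mulr_ge0.
have mI : measurable_fun setT I.
  have mu_abs' : measurable_fun setT
      (fun z : sample * d.-tuple R => `|eta z.2 - theta|).
    exact: (measurableT_comp mu_abs measurable_snd).
  apply: (@measurable_fun_fubini_tonelli_F _ _ _ _ _ _
    (fun z => (`|eta z.2 - theta| * (0 < `|eta z.2 - theta| <= Z z)%R%:R)%:E)).
    apply/measurable_EFinP; apply: measurable_funM => //.
    rewrite -indic_boolE; apply: measurable_indic; apply: measurable_bool_set.
    by apply: measurable_and; [exact: measurable_fun_ltr|exact: measurable_fun_ler].
  by move=> z; rewrite lee_fin mulr_ge0.
have mexc : measurable_fun setT (fun D : sample =>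
    excess_F1 P gstar (plugin_classifier (etahat D.1) (thetahat D))).
  apply: measurable_funB => //.
  apply: (@measurable_F1 _ _ _ _ _
    (fun z : sample * d.-tuple R => thetahat z.1 < etahat z.1.1 z.2)).
    apply: measurable_fun_ltr; first exact: (measurableT_comp mthetahat measurable_fst).
    have mpair : measurable_fun setT (fun z : sample * d.-tuple R => (z.1.1, z.2)).
      apply: measurable_fun_pair => //.
      exact: (measurableT_comp measurable_fst measurable_fst).
    exact: (measurableT_comp metahat mpair).
have metahat1 Dn : measurable_fun setT (etahat Dn).
  exact: (measurableT_comp metahat (measurable_pair1 Dn)).
(* On [B1] or [B2] the excess is at most 1; on every other sample [plugin_excess_le] applies with
   radius [Z]. *)
have pointwise w : ((excess_F1 P gstar (plugin_classifier (etahat w.1) (thetahat w)))%:E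
    <= (\1_B1 w)%:E + (\1_B2 w)%:E + p^-1%:E * I w)%E.
  have pI0 : (0 <= p^-1%:E * I w)%E by rewrite mule_ge0// lee_fin invr_ge0 ltW.
  have e1 := excess_F1_le1 (plugin_classifier (etahat w.1) (thetahat w))
    p0 pP heta htheta mgstar.
  have [wA|wA] := leP (p / 4) (A w).
    rewrite -[leLHS]adde0; apply: leeD => //; rewrite -EFinD lee_fin.
    by rewrite indicE mem_set//= (le_trans e1)// lerDl indicE.
  have [wS|wS] := leP (p / 4) (S w).
    rewrite -[leLHS]adde0; apply: leeD => //; rewrite -EFinD lee_fin.
    by rewrite [X in _ + X]indicE mem_set//= (le_trans e1)// lerDr indicE.
  rewrite -[leLHS]add0e; apply: leeD.
    by rewrite -EFinD lee_fin addr_ge0// indicE.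
  apply: (plugin_excess_le (S := S w) (T := T w) p0 pP heta htheta
    mgstar (metahat1 w.1) N0) => //.
  by move=> t; rewrite [w in thetahat w]surjective_pairing; exact: uthetahat.
have Irate : (\int[mu]_w I w <= (C0' * (1 + 2 * KZ * 2 `^ (1 + alpha)) * rate)%:E)%E.
  apply: (peeling alpha0 C0'_gt0 KZ_gt0 b0 alpham mu_abs _ mZ margin_all tail_Z).
  move=> x; have := eta01 x; have := theta01; rewrite normr_ge0 ler_norml; lra.
apply: (@le_trans _ _ (\int[mu]_w ((\1_B1 w)%:E + (\1_B2 w)%:E + p^-1%:E * I w))%E).
  apply: ge0_le_integral => //.
  (* Optimality of [gstar] makes the excess nonnegative, as the comparison of integrals requires. *)
  - move=> w _; rewrite lee_fin subr_ge0; apply: gopt.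
    exact: measurable_fun_ltr.
  - exact/measurable_EFinP.
  apply: emeasurable_funD; last exact: measurable_funeM.
  by apply: emeasurable_funD; apply/measurable_EFinP; exact: measurable_indic.
have mi (B : set sample) : measurable B ->
    measurable_fun setT (fun w => (\1_B w)%:E : \bar R).
  by move=> mB; apply/measurable_EFinP; exact: measurable_indic.
rewrite ge0_integralD//; last 4 first.
- by move=> w _; rewrite -EFinD lee_fin addr_ge0// indicE.
- by apply: emeasurable_funD; exact: mi.
- by move=> w _; rewrite mule_ge0// lee_fin invr_ge0 ltW.
- exact: measurable_funeM.
rewrite ge0_integralD//; [|exact: mi|exact: mi].
rewrite !integral_indic// !setIT ge0_integralZl//; last by rewrite lee_fin invr_ge0 ltW.
apply: (@le_trans _ _ (rate_constant * rate)%:E).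
  rewrite /rate_constant 2!mulrDl !EFinD; apply: leeD; first apply: leeD.
  - by apply: bad_le => //; exact: tail_A.
  - by apply: bad_le => //; exact: tail_S.
  rewrite -[X in (_ <= X%:E)%E]mulrA [X in (_ <= X)%E]EFinM.
  by apply: lee_wpmul2l => //; rewrite lee_fin invr_ge0 ltW.
(* Since b is the smaller of a and N, its rate is one of the two summands and the other is
   nonnegative. *)
rewrite lee_fin ler_wpM2l ?(ltW rate_constant_gt0)// /rate /b.
by case: (leP a N%:R) => _; rewrite ?lerDl ?lerDr powR_ge0.
Qed.

End estimator.
End rate.

Theorem theorem3 (R : realType) (alpha C0 delta0 C1 C2 p : R) :
  0 <= alpha -> 0 < C0 -> 0 < delta0 <= 12^-1 -> 0 < C1 -> 0 < C2 -> 0 < p ->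
  exists C : R, 0 < C /\
    forall (d : nat) (P : probability (d.-tuple R * bool)%type R)
      (eta : d.-tuple R -> R) (thetastar : R) (gstar : d.-tuple R -> bool)
      (n N : nat) (a : nat -> R)
      (etahat : n.-tuple (d.-tuple R * bool) -> d.-tuple R -> R)
      (thetahat : n.-tuple (d.-tuple R * bool) * N.-tuple (d.-tuple R) -> R),
    (p%:E <= P label1)%E ->
    regression_function P eta ->
    optimal_threshold P eta thetastar ->
    F1_optimal P gstar ->
    margin_assumption P eta thetastar alpha C0 delta0 ->
    (0 < N)%N -> (n <= N)%N ->
    (forall m, 0 <= a m) -> nondecreasing_seq a -> 0 < a n ->
    measurable_fun setT
      (fun z : n.-tuple (d.-tuple R * bool) * d.-tuple R => etahat z.1 z.2) ->
    (forall t : R, 0 < t ->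
      {ae lawX P, forall x,
        (iid_law P n [set Dn | (t <= `|etahat Dn x - eta x|)%R]
           <= (C1 * expR (- (C2 * a n * t ^+ 2)))%:E)%E}) ->
    plugin_threshold etahat thetahat ->
    (\int[iid_law P n \x iid_law (lawX P) N]_D
        (excess_F1 P gstar (plugin_classifier (etahat D.1) (thetahat D)))%:E
     <= (C * (a n `^ (- ((1 + alpha) / 2)) +
              N%:R `^ (- ((1 + alpha) / 2))))%:E)%E.

Proof.
move=> alpha0 C0_gt0 /andP[delta0_gt0 _] C1_gt0 C2_gt0 p0.
(* The constant is fixed before the dimension, the law and the sample sizes. *)
exists (rate_constant alpha C0 delta0 C1 C2 p).
split; first exact: rate_constant_gt0.
move=> d P eta thetastar gstar n N a etahat thetahat pP heta htheta hgstar margin.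
move=> N0 _ _ _ an0 metahat tail hthetahat.
exact: (expected_excess_le alpha0 C0_gt0 delta0_gt0 C1_gt0 C2_gt0 p0 pP heta
  htheta hgstar margin N0 an0 metahat tail hthetahat).
Qed.
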